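(* Let $(X,d_0)$ be the pillow space and let $d_{SL}$ be a symmetric Loewner metric on $X$ such that the identity map $(X,d_0)\to(X,d_{SL})$ is quasisymmetric. Let $\Sigma$ be a sheet of $X$. Then there is a measure $\nu$ on $\Sigma$ making $(\Sigma,d_{SL},\nu)$ a PI space.
   Context: **Pillow space.** Let $X_0=[0,1]^2$, divided into nine congruent closed squares of side $1/3$. Let $X_1$ be the union of these nine squares and a second copy of the central one, glued to the original central square along its boundary; let $\mathcal C$ be the set of the ten squares of $X_1$. Let $\pi:X_1\to X_0$ be the natural projection identifying the two copies of the central square. Let $\phi:[0,3]\to[0,1]$ be $\phi(t)=t$ on $[0,1]$, $2-t$ on $[1,2]$, $t-2$ on $[2,3]$, and let $S:X_1\to X_0$ be $S(x)=(\phi(3a),\phi(3b))$ where $\pi(x)=(a,b)$; $S$ maps each $c\in\mathcal C$ bijectively onto $X_0$, scaling by $3$. For $n\ge 1$ let $X_n=\{(x_1,\dots,x_n)\in X_1^n: \pi(x_{i+1})=S(x_i),\ 1\le i<n\}$. For $(c_1,\dots,c_n)\in\mathcal C^n$ the corresponding cell of $X_n$ is $\{(x_1,\dots,x_n)\in X_n: x_i\in c_i \ \forall i\}$; the map $(x_1,\dots,x_n)\mapsto\pi(x_1)$ sends each cell bijectively onto a square of side $3^{-n}$. The metric $d_n(x,y)$ on $X_n$ is the infimum of $\sum_{j=0}^{m-1}|\pi(x^j_1)-\pi(x^{j+1}_1)|$ over finite chains $x=x^0,x^1,\dots,x^m=y$ in $X_n$ such that each consecutive pair lies in a common cell. The pillow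 space is $X=\{(x_i)_{i=1}^\infty: x_i\in X_1,\ \pi(x_{i+1})=S(x_i)\ \forall i\ge1\}$ with $d_0(x,y)=\lim_{n\to\infty}d_n((x_1,\dots,x_n),(y_1,\dots,y_n))$; it is a compact geodesic metric space. **Symmetric metrics and sheets.** Let $\iota_0:X_1\to X_1$ be the identity and $\iota_1:X_1\to X_1$ the map exchanging the two copies of the central square (so $\pi\circ\iota_1=\pi$) and fixing all other squares pointwise. For $w=(w_i)\in G=\mathbb Z_2^{\mathbb N}$ let $\iota_w:X\to X$, $\iota_w((x_i)_i)=(\iota_{w_i}(x_i))_i$. A metric on $X$ is symmetric if every $\iota_w$, $w\in G$, is an isometry for it. Let $s_0,s_1:X_0\to X_1$ be the two continuous right inverses of $\pi$, whose images contain the first, respectively the second, copy of the central square. Let $T:X_0\to X_0$, $T=S\circ s_0=S\circ s_1$. For $w\in G$ let $s_w:X_0\to X$, $s_w(y)=(s_{w_1}(y),s_{w_2}(Ty),s_{w_3}(T^2y),\dots)$. The sheets of $X$ are the sets $s_w(X_0)$, $w\in G$. **Quasisymmetry.** A homeomorphism $f:(Z,d_Z)\to(W,d_W)$ is quasisymmetric if there is a homeomorphism $\eta:[0,\infty)\to[0,\infty)$ with $\frac{d_W(f(x),f(y))}{d_W(f(x),f(z))}\le\eta\left(\frac{d_Z(x,y)}{d_Z(x,z)}\right)$ for all $x,y,z\in Z$ with $x\ne z$. **PI and Loewner.** Measures are Radon. A complete metric measure space $(Z,d,\mu)$ is a $p$-PI space ($1\le p<\infty$) if $\mu$ is doubling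 ($\mu(B(x,2r))\le C\mu(B(x,r))$, balls having positive finite measure) and there is $C>0$ with $\frac{1}{\mu(B)}\int_B|u-u_B|\,d\mu\le C\,\mathrm{diam}(B)\left(\frac1{\mu(CB)}\int_{CB}\mathrm{Lip}[u]^p\,d\mu\right)^{1/p}$ for every ball $B$ and every compactly supported Lipschitz $u:Z\to\mathbb R$, where $u_B$ is the $\mu$-average of $u$ on $B$ and $\mathrm{Lip}[u](x)=\limsup_{r\to0}\sup_{y\in B(x,r)}\frac{|u(y)-u(x)|}{r}$. A PI space is a $p$-PI space for some $p$. A space $Z$ is Ahlfors $Q$-regular if $C^{-1}r^Q\le\mathcal H^Q(B(x,r))\le Cr^Q$ for all $x\in Z$, $0<r\le 2\,\mathrm{diam}(Z)$. ''$Q$-Loewner'' ($Q>1$) means Ahlfors $Q$-regular and Loewner with exponent $Q$, and may be taken to mean: complete, Ahlfors $Q$-regular, and $(Z,d,\mathcal H^Q)$ is a $Q$-PI space (equivalent by Heinonen–Koskela). ''Loewner'' means $Q$-Loewner for some $Q>1$. *)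

(* Defs.v *)
From HB Require Import structures.
From mathcomp Require Import all_boot all_order all_algebra.
From mathcomp Require Import all_classical all_reals all_analysis.
From mathcomp Require Import ring lra zify.
Set Implicit Arguments.
Unset Strict Implicit.
Unset Printing Implicit Defensive.
Import Order.TTheory GRing.Theory Num.Theory.
Import numFieldNormedType.Exports.

Local Open Scope classical_set_scope.
Local Open Scope ring_scope.

(* Measurable types of the library are pointed, so spaces carrying a measure are
   pointed; the point plays no role. *)
#[short(type="pmetricType")]
HB.structure Definition PMetric (R : numDomainType) :=
  { M of Metric R M & Pointed M }.

Record metric_on (R : realType) (T : Type) := MetricOn {
  dist :> T -> T -> R ;
  distxx : forall x, dist x x = 0 ;
  dist_eq0 : forall x y, dist x y = 0 -> x = y ;
  dist_sym : forall x y, dist x y = dist y x ;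
  dist_triangle : forall y x z, dist x z <= dist x y + dist y z }.

(* The carrier T as a library metric space, with the topology of the metric d;
   T itself carries several metrics. *)
Definition metric_space (R : realType) (T : Type) (d : metric_on R T) : Type := T.

HB.instance Definition _ (R : realType) (T : Type) (d : metric_on R T) :=
  gen_eqMixin (metric_space d).
HB.instance Definition _ (R : realType) (T : Type) (d : metric_on R T) :=
  gen_choiceMixin (metric_space d).
HB.instance Definition _ (R : realType) (T : Type) (d : metric_on R T) :=
  isMetric.Build R (metric_space d)
    (distxx d) (@dist_eq0 _ _ d) (dist_sym d) (dist_triangle d).
HB.instance Definition _ (R : realType) (T : pointedType) (d : metric_on R T) :=
  isPointed.Build (metric_space d) (point : T).

Lemma set_type_val_inj (T : Type) (A : set T) (x y : A) : val x = val y -> x = y.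
Proof.
case: x y => [x xA] [y yA] /= xy; subst y.
by congr exist; exact: bool_irrelevance.
Qed.

Definition restrict_metric (R : realType) (T : Type) (A : set T)
    (d : metric_on R T) : metric_on R A :=
  @MetricOn R A (fun x y => d (val x) (val y))
    (fun x => distxx d (val x))
    (fun x y dxy => set_type_val_inj (dist_eq0 dxy))
    (fun x y => dist_sym d (val x) (val y))
    (fun y x z => dist_triangle d (val y) (val x) (val z)).

Definition borel (R : realType) (Z : pmetricType R) : Type :=
  g_sigma_algebraType (@open Z).
HB.instance Definition _ (R : realType) (Z : pmetricType R) :=
  Measurable.on (borel Z).

Section metric_measure.
Context {R : realType}.
Implicit Types (Z : pmetricType R).

(* The maximum with 0 gives the empty set diameter 0 instead of -oo. *)
Definition diam Z (A : set Z) : \bar R :=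
  maxe 0%E (ereal_sup [set (mdist x.1 x.2)%:E | x in A `*` A]).

(* Unnormalized: the usual constant factor affects neither Ahlfors regularity
   nor the Poincare inequality. *)
Definition hausdorff_pre Z (s delta : R) (A : set Z) : \bar R :=
  ereal_inf [set (\sum_(i <oo) (diam (F i) `^ s))%E | F in
    [set F : (set Z)^nat | A `<=` \bigcup_i F i /\
       forall i, (diam (F i) <= delta%:E)%E]].
Definition hausdorff Z (s : R) (A : set Z) : \bar R :=
  ereal_sup [set hausdorff_pre s delta A | delta in [set delta | 0 < delta]].

Definition complete_metric Z :=
  forall F : set_system Z, ProperFilter F -> cauchy F -> cvg F.

Definition radon Z (mu : {measure set (borel Z) -> \bar R}) :=
  [/\ forall K : set Z, compact K -> (mu K < +oo)%E,
      forall A : set (borel Z), measurable A ->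
        mu A = ereal_inf [set mu U | U in [set U : set Z | open U /\ A `<=` U]]
    & forall U : set Z, open U ->
        mu U = ereal_sup [set mu K | K in [set K : set Z | compact K /\ K `<=` U]]].

Definition doubling Z (mu : {measure set (borel Z) -> \bar R}) :=
  (forall (x : Z) (r : R), 0 < r -> (0 < mu (ball x r) < +oo)%E) /\
  exists C : R, forall (x : Z) (r : R), 0 < r ->
    (mu (ball x (2 * r)) <= C%:E * mu (ball x r))%E.

Definition average Z (mu : {measure set (borel Z) -> \bar R}) (B : set Z)
    (f : Z -> \bar R) : \bar R :=
  (((fine (mu B))^-1)%:E * \int[mu]_(x in (B : set (borel Z))) f x)%E.

Definition lipschitz_fun Z (u : Z -> R) :=
  exists L : R, forall x y, `|u x - u y| <= L * mdist x y.

Definition compactly_supported Z (u : Z -> R) :=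
  compact (closure [set x | u x != 0]).

(* Pointwise upper Lipschitz constant, balls being open. *)
Definition Lip Z (u : Z -> R) (x : Z) : \bar R :=
  limf_esup (fun r : R => ereal_sup [set (`|u y - u x| / r)%:E | y in ball x r])
    (0^'+).

Definition poincare Z (mu : {measure set (borel Z) -> \bar R}) (p : R) :=
  exists2 C : R, 0 < C &
  forall (x : Z) (r : R) (u : Z -> R), 0 < r ->
    lipschitz_fun u -> compactly_supported u ->
    let B := ball x r in
    let CB := ball x (C * r) in
    let uB := fine (average mu B (fun y => (u y)%:E)) in
    (average mu B (fun y => `|u y - uB|%:E)
      <= C%:E * diam B * (average mu CB (fun y => Lip u y `^ p)) `^ p^-1)%E.

Definition pPI_space Z (p : R) (mu : {measure set (borel Z) -> \bar R}) :=
  [/\ 1 <= p, complete_metric Z, radon mu, doubling mu & poincare mu p].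

Definition PI_space Z (mu : {measure set (borel Z) -> \bar R}) :=
  exists p : R, pPI_space p mu.

Definition ahlfors_regular Z (Q : R) :=
  exists2 C : R, 0 < C & forall (x : Z) (r : R),
    0 < r -> (r%:E <= 2%:E * diam [set: Z])%E ->
    ((C^-1 * r `^ Q)%:E <= hausdorff Q (ball x r) <= (C * r `^ Q)%:E)%E.

(* The measure mu is the restriction of the Hausdorff outer measure to the
   Borel sets. *)
Definition loewner_exp Z (Q : R) :=
  [/\ 1 < Q, complete_metric Z, ahlfors_regular Z Q &
      exists2 mu : {measure set (borel Z) -> \bar R},
        (forall A : set (borel Z), measurable A -> mu A = hausdorff Q (A : set Z))
        & pPI_space Q mu].

Definition loewner Z := exists Q : R, loewner_exp Z Q.

Definition homeomorphism (T U : topologicalType) (f : T -> U) :=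
  exists g : U -> T, [/\ cancel f g, cancel g f, continuous f & continuous g].

Definition halfline : set R := [set t | 0 <= t].

Definition quasisymmetric (Z W : metricType R) (f : Z -> W) :=
  homeomorphism f /\
  exists2 eta : halfline -> halfline, homeomorphism eta &
    forall (x y z : Z) (t : halfline), x <> z ->
      val t = mdist x y / mdist x z ->
      mdist (f x) (f y) / mdist (f x) (f z) <= val (eta t).
End metric_measure.

Section pillow_definitions.
Context {R : realType}.
Local Notation pt := (R * R * bool)%type.

Definition unit_square : set (R * R) :=
  [set p | 0 <= p.1 <= 1 /\ 0 <= p.2 <= 1].

Definition in_center (p : R * R) : bool :=
  (3^-1 < p.1 < 2 / 3) && (3^-1 < p.2 < 2 / 3).

Definition grid_square (i j : nat) : set (R * R) :=
  [set p | i%:R / 3 <= p.1 <= i.+1%:R / 3 /\ j%:R / 3 <= p.2 <= j.+1%:R / 3].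

(* A point of X1 is a pair (p, k) where p is its projection and k tells the two
   copies of the central square apart. The copies are glued along their
   boundary, so k = true is allowed only over the open central square. *)
Definition X1 : set pt :=
  [set x : pt | unit_square x.1 /\ (x.2 -> in_center x.1)].

(* The nine original squares; first_square 1 1 is the first copy of the central
   one. *)
Definition first_square (i j : nat) : set pt :=
  [set x : pt | grid_square i j x.1 /\ x.2 = false].
Definition second_center : set pt :=
  [set x : pt | grid_square 1 1 x.1 /\ x.2 = in_center x.1].
Definition squares : set (set pt) :=
  [set c | c = second_center \/
    exists i j, [/\ (i < 3)%N, (j < 3)%N & c = first_square i j]].

Definition proj (x : pt) : R * R := x.1.

Definition fold3 (t : R) : R :=
  if t <= 1 then t else if t <= 2 then 2 - t else t - 2.

Definition S_map (x : pt) : R * R :=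
  (fold3 (3 * (proj x).1), fold3 (3 * (proj x).2)).

(* Xn n is the space usually written X_(n+1): its points are sequences of n+1
   points of X1, the first of which has index 0. The same shift applies to dn
   and prefix. *)
Definition Xn (n : nat) : set ('I_n.+1 -> pt) :=
  [set x | (forall i, X1 (x i)) /\
    forall i j : 'I_n.+1, j = i.+1 :> nat -> proj (x j) = S_map (x i)].
Arguments Xn : clear implicits.

Definition cell n (c : 'I_n.+1 -> set pt) :
    set ('I_n.+1 -> pt) :=
  [set x | Xn n x /\ forall i, c i (x i)].

Definition in_common_cell n (x y : 'I_n.+1 -> pt) :=
  exists2 c : 'I_n.+1 -> set pt,
    (forall i, squares (c i)) & cell c x /\ cell c y.

(* The library norm on R * R is the maximum norm. *)
Definition euclid (p q : R * R) : R :=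
  Num.sqrt ((p.1 - q.1) ^+ 2 + (p.2 - q.2) ^+ 2).

Definition is_chain n (x y : 'I_n.+1 -> pt) (m : nat)
    (z : nat -> 'I_n.+1 -> pt) :=
  [/\ z 0%N = x, z m = y, (forall j, (j <= m)%N -> Xn n (z j)) &
      forall j, (j < m)%N -> in_common_cell (z j) (z j.+1)].

Definition chain_length n (m : nat) (z : nat -> 'I_n.+1 -> pt) : R :=
  \sum_(j < m) euclid (proj (z j ord0)) (proj (z j.+1 ord0)).

Definition dn n (x y : 'I_n.+1 -> pt) : R :=
  inf [set l | exists m z, is_chain x y m z /\ l = chain_length m z].

Definition pillow_set : set (nat -> pt) :=
  [set x | (forall i, X1 (x i)) /\ forall i, proj (x i.+1) = S_map (x i)].

Definition prefix n (x : nat -> pt) (i : 'I_n.+1) : pt := x i.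
Arguments prefix : clear implicits.

(* The right inverse of proj whose image contains the first (k = false) or the
   second (k = true) copy of the central square. *)
Definition section1 (k : bool) (p : R * R) : pt :=
  (p, k && in_center p).

Definition T_map (p : R * R) : R * R := S_map (section1 false p).

(* swap false is the identity and swap true exchanges the two copies of the
   central square. *)
Definition swap (k : bool) (x : pt) : pt :=
  if k && in_center (proj x) then (proj x, ~~ x.2) else x.

Lemma S_section1 k p : S_map (section1 k p) = T_map p. Proof. by []. Qed.

Lemma fold3_unit t : 0 <= t <= 1 -> 0 <= fold3 (3 * t) <= 1.
Proof. rewrite /fold3 => t01; case: ifPn => h; [lra|case: ifPn => h'; lra]. Qed.

Lemma T_unit p : unit_square p -> unit_square (T_map p).
Proof. by move=> [p1 p2]; split => /=; exact: fold3_unit. Qed.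

Lemma iterT_unit i p : unit_square p -> unit_square (iter i T_map p).
Proof. by move=> p01; elim: i => //= i; exact: T_unit. Qed.

Lemma section1_X1 k p : unit_square p -> X1 (section1 k p).
Proof. by move=> p01; split => //= /andP[]. Qed.

Lemma lift_pillow (w : nat -> bool) p : unit_square p ->
  pillow_set (fun i => section1 (w i) (iter i T_map p)).
Proof.
by move=> p01; split => // i; apply: section1_X1; exact: iterT_unit.
Qed.

Lemma swap_pillow (w : nat -> bool) x : pillow_set x ->
  pillow_set (fun i => swap (w i) (x i)).
Proof.
have sP k y : proj (swap k y) = proj y by rewrite /swap; case: ifP.
have sS k y : S_map (swap k y) = S_map y by rewrite /S_map sP.
move=> [x1 xS]; split=> i; last by rewrite sP sS.
split; first by rewrite -/(proj _) sP; exact: (x1 i).1.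
rewrite /swap; case: ifP => [/andP[]//|_]; exact: (x1 i).2.
Qed.

Lemma unit_square0 : unit_square (0, 0).
Proof. by split => /=; lra. Qed.
End pillow_definitions.
Arguments prefix {R} n x i.

Definition pillow (R : realType) : Type := @pillow_set R.

Definition to_pillow (R : realType) (x : nat -> R * R * bool)
    (x_pillow : pillow_set x) : pillow R :=
  exist (fun x => x \in pillow_set) x (mem_set x_pillow).

HB.instance Definition _ (R : realType) := gen_eqMixin (pillow R).
HB.instance Definition _ (R : realType) := gen_choiceMixin (pillow R).
HB.instance Definition _ (R : realType) := isPointed.Build (pillow R)
  (to_pillow (lift_pillow (fun=> false) unit_square0)).

Section pillow_maps.
Context {R : realType}.
Local Notation pt := (R * R * bool)%type.

Definition iota_map (w : nat -> bool) (x : pillow R) : pillow R :=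
  to_pillow (swap_pillow w (set_mem (valP x))).

Definition sheet_map (w : nat -> bool) (p : @unit_square R) : pillow R :=
  to_pillow (lift_pillow w (set_mem (valP p))).

Definition sheet (w : nat -> bool) : set (pillow R) := range (sheet_map w).

Definition symmetric_metric (d : metric_on R (pillow R)) :=
  forall w x y, d (iota_map w x) (iota_map w y) = d x y.

Definition d0 (x y : pillow R) : R :=
  limn (fun n => dn (prefix n (val x)) (prefix n (val y))).
End pillow_maps.

Section metric_proof.
Context {R : realType}.
Local Notation pt := (R * R * bool)%type.

Lemma euclid_ge0 (p q : R * R) : 0 <= euclid p q.
Proof. exact: sqrtr_ge0. Qed.

Lemma euclid_sym (p q : R * R) : euclid p q = euclid q p.
Proof. by rewrite /euclid; congr Num.sqrt; ring. Qed.

Lemma euclidl (p q : R * R) : `|p.1 - q.1| <= euclid p q.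
Proof. by rewrite -sqrtr_sqr ler_wsqrtr// lerDl sqr_ge0. Qed.

Lemma euclidr (p q : R * R) : `|p.2 - q.2| <= euclid p q.
Proof. by rewrite -sqrtr_sqr ler_wsqrtr// lerDr sqr_ge0. Qed.

Lemma euclid_l (a a' b : R) : euclid (a, b) (a', b) = `|a - a'|.
Proof. by rewrite /euclid /= subrr expr0n /= addr0 sqrtr_sqr. Qed.

Lemma euclid_r (a b b' : R) : euclid (a, b) (a, b') = `|b - b'|.
Proof. by rewrite /euclid /= subrr expr0n /= add0r sqrtr_sqr. Qed.

Section chains.
Variable n : nat.
Implicit Types x y : 'I_n.+1 -> pt.

Definition chained x y l := exists m z, is_chain x y m z /\ l = chain_length m z.

Lemma common_cell_sym x y : in_common_cell x y -> in_common_cell y x.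
Proof. by move=> [c sc [xc yc]]; exists c. Qed.

Lemma chained_ge0 x y l : chained x y l -> 0 <= l.
Proof. by move=> [m [z [_ ->]]]; apply: sumr_ge0 => i _; exact: euclid_ge0. Qed.

Lemma chained_refl x : Xn x -> chained x x 0.
Proof.
move=> Xx; exists 0%N, (fun=> x); split; first by split.
by rewrite /chain_length big_ord0.
Qed.

Lemma chained_cons x y y' l : Xn x -> in_common_cell x y -> chained y y' l ->
  chained x y' (euclid (proj (x ord0)) (proj (y ord0)) + l).
Proof.
move=> Xx xy [m [z [[z0 zm Xz cz] ->]]].
exists m.+1, (fun j => if j is j'.+1 then z j' else x); split.
  split => //; first by case.
  by case => [|j]; rewrite ?z0// ltnS => /cz.
by rewrite /chain_length big_ord_recl /= z0.
Qed.

Lemma chained_ind (P : ('I_n.+1 -> pt) -> R -> Prop) y :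
  P y 0 ->
  (forall x x' l, Xn x -> in_common_cell x x' -> chained x' y l -> P x' l ->
     P x (euclid (proj (x ord0)) (proj (x' ord0)) + l)) ->
  forall x l, chained x y l -> P x l.
Proof.
move=> P0 PS x l [m [z [zc ->]]]; elim: m x z zc => [|m IH] x z [z0 zm Xz cz].
  by rewrite /chain_length big_ord0 -z0 zm.
rewrite /chain_length big_ord_recl /= z0.
have zc' : is_chain (z 1%N) y m (z \o succn).
  by split => //= j jm; [exact: Xz|exact: cz].
apply: PS; last exact: IH zc'.
- by rewrite -z0; exact: Xz.
- by rewrite -z0; exact: cz.
- by exists m, (z \o succn).
Qed.

Lemma chained_cat x y y' l l' : chained x y l -> chained y y' l' ->
  chained x y' (l + l').
Proof.
move=> xyl yyl'; move: x l xyl.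
apply: chained_ind => [|x x' l Xx xx' _ IH]; first by rewrite add0r.
by rewrite -addrA; exact: chained_cons.
Qed.

Lemma common_cell_Xn x y : in_common_cell x y -> Xn x.
Proof. by move=> [c _ [[]]]. Qed.

Lemma chained_step x y : in_common_cell x y ->
  chained x y (euclid (proj (x ord0)) (proj (y ord0))).
Proof.
move=> xy; rewrite -[euclid _ _]addr0; apply: chained_cons (xy) _.
  exact: common_cell_Xn xy.
exact: chained_refl (common_cell_Xn (common_cell_sym xy)).
Qed.

Lemma chained_sym x y l : Xn y -> chained x y l -> chained y x l.
Proof.
move=> Xy; move: x l; apply: chained_ind => [|x x' l Xx xx' _ IH].
  exact: chained_refl.
rewrite addrC; apply: chained_cat IH _.
rewrite euclid_sym; apply: chained_step; exact: common_cell_sym.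
Qed.

Lemma dn_le x y l : chained x y l -> dn x y <= l.
Proof. by move=> xyl; apply: ge_inf => //; exists 0 => ? /chained_ge0. Qed.

Lemma dn_ge x y k : (exists l, chained x y l) ->
  (forall l, chained x y l -> k <= l) -> k <= dn x y.
Proof. by move=> xy kxy; apply: lb_le_inf. Qed.

Lemma chained_lip x y (f : ('I_n.+1 -> pt) -> R) :
  (forall x x', in_common_cell x x' ->
    `|f x - f x'| <= euclid (proj (x ord0)) (proj (x' ord0))) ->
  forall l, chained x y l -> `|f x - f y| <= l.
Proof.
move=> fl; move: x; apply: chained_ind => [|x x' l _ /fl xx' _ IH].
  by rewrite subrr normr0.
by apply: le_trans (lerD xx' IH); exact: ler_distD.
Qed.

End chains.

Lemma triadic_ex K (M a : R) : (0 < K)%N -> 0 < M -> 0 <= a <= K%:R / M ->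
  exists2 k, (k < K)%N & k%:R / M <= a <= k.+1%:R / M.
Proof.
move=> K0 M0; elim: K K0 => // K IH _ /andP[a0 aK].
have [K0|K0] := posnP K.
  by exists 0%N; rewrite ?K0 // mul0r a0 /=; rewrite K0 in aK.
have [/ltW aK'|aK'] := ltP a (K%:R / M).
  have [|k kK ka] := IH K0; first by rewrite a0.
  by exists k => //; exact: ltnW.
by exists K => //; rewrite aK' aK.
Qed.

Definition triadic N (a a' : R) := exists2 k : nat, (k < 3 ^ N)%N &
  (k%:R / 3 ^+ N <= a <= k.+1%:R / 3 ^+ N) /\
  (k%:R / 3 ^+ N <= a' <= k.+1%:R / 3 ^+ N).

Lemma triadic_fold N a a' : triadic N.+1 a a' ->
  (exists2 j : nat, (j < 3)%N & (j%:R / 3 <= a <= j.+1%:R / 3) /\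
    (j%:R / 3 <= a' <= j.+1%:R / 3)) /\
  triadic N (fold3 (3 * a)) (fold3 (3 * a')).
Proof.
move=> [k k3 [ka ka']].
set M := (3 ^ N)%N in k3.
have M0 : (0 < M)%N by rewrite expn_gt0.
pose j := (k %/ M)%N; pose r := (k %% M)%N.
have j3 : (j < 3)%N by rewrite ltn_divLR // mulnC -expnSr.
have rM : (r < M)%N by rewrite ltn_mod.
have kE : k = (j * M + r)%N by exact: divn_eq.
pose m : R := 3 ^+ N.
have m0 : 0 < m by exact: exprn_gt0.
have ME : M%:R = m by rewrite natrX.
have r1 : r.+1%:R <= m by rewrite -ME ler_nat.
have r0 : (0 : R) <= r%:R by [].
pose q : R := r%:R / m; pose q' : R := r.+1%:R / m.
have q0 : 0 <= q by rewrite divr_ge0 // ltW.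
have q'1 : q' <= 1 by rewrite ler_pdivrMr // mul1r.
have E1 : k%:R / 3 ^+ N.+1 = (j%:R + q) / 3.
  rewrite kE natrD natrM ME exprS -/m /q; field; lra.
have E2 : k.+1%:R / 3 ^+ N.+1 = (j%:R + q') / 3.
  rewrite kE -addnS natrD natrM ME exprS -/m /q'; field; lra.
rewrite E1 E2 in ka ka'.
split.
  exists j => //; rewrite -(@natr1 R j); split; lra.
case: j j3 kE E1 E2 ka ka' => [|[|[|//]]] _ _ _ _ ka ka'.
- have H b : (0%:R + q) / 3 <= b <= (0%:R + q') / 3 -> q <= fold3 (3 * b) <= q'.
    by move=> hb; rewrite /fold3; case: ifPn => h1; [|case: ifPn => h2]; lra.
  by exists r => //; rewrite -/m -/q -/q'; split; exact: H.
- have H b : (1%:R + q) / 3 <= b <= (1%:R + q') / 3 ->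
      1 - q' <= fold3 (3 * b) <= 1 - q.
    by move=> hb; rewrite /fold3; case: ifPn => h1; [|case: ifPn => h2]; lra.
  exists (M - r.+1)%N; first by rewrite -/M; lia.
  rewrite -/m -subSn // subSS !natrB ?ME; [|exact: ltnW|by []].
  rewrite !mulrBl divff ?gt_eqF // -/q -/q'.
  by split; exact: H.
- have H b : (2%:R + q) / 3 <= b <= (2%:R + q') / 3 -> q <= fold3 (3 * b) <= q'.
    by move=> hb; rewrite /fold3; case: ifPn => h1; [|case: ifPn => h2]; lra.
  by exists r => //; rewrite -/m -/q -/q'; split; exact: H.
Qed.

Lemma prefix_Xn n (x : nat -> pt) : pillow_set x -> Xn (prefix n x).
Proof.
by move=> [x1 xS]; split => [i|i j ij]; [exact: x1|rewrite /prefix ij].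
Qed.

Definition lift_seq (w : nat -> bool) (p : R * R) (i : nat) : pt :=
  section1 (w i) (iter i T_map p).

Lemma lift_cell n w (p q : R * R) : unit_square p -> unit_square q ->
  triadic n.+1 p.1 q.1 -> triadic n.+1 p.2 q.2 ->
  in_common_cell (prefix n (lift_seq w p)) (prefix n (lift_seq w q)).
Proof.
move=> p01 q01 pq1 pq2.
have tri i : (i <= n)%N ->
    triadic (n - i).+1 (iter i T_map p).1 (iter i T_map q).1 /\
    triadic (n - i).+1 (iter i T_map p).2 (iter i T_map q).2.
  elim: i => [|i IH] lin; first by rewrite subn0.
  have [] := IH (ltnW lin).
  by rewrite -(subnSK lin) => /triadic_fold[_ ?] /triadic_fold[_ ?]; split.
suff : forall i : 'I_n.+1, exists2 c : set pt, squares c &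
    c (lift_seq w p i) /\ c (lift_seq w q i).
  move=> /(_ _)/cid2-/all_sig[c cP]; exists c; first by move=> i; have [] := cP i.
  by split; split=> [|i]; (try by apply: prefix_Xn; exact: lift_pillow);
    have [_ []] := cP i.
move=> i.
have [] := tri i (ltn_ord i).
move=> /triadic_fold[[j j3 [j1 j2]] _] /triadic_fold[[k k3 [k1 k2]] _].
have [wj|wj] := boolP [&& w i, j == 1%N & k == 1%N].
  move: wj j1 j2 k1 k2 => /and3P[wi /eqP-> /eqP->] j1 j2 k1 k2.
  exists second_center; first by left.
  by split; split=> //=; rewrite wi.
exists (first_square j k); first by right; exists j, k.
have H (r : R * R) : grid_square j k r -> w i && in_center r = false.
  move=> [r1 r2]; apply/negbTE; apply: contra wj => /andP[-> /andP[c1 c2]] /=.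
  case: j j3 j1 j2 r1 => [|[|[|//]]] _ _ _ r1; try lra.
  by case: k k3 k1 k2 r2 => [|[|[|//]]] _ _ _ r2; try lra.
split; split=> //=; apply: H; split => //.
Qed.

Lemma chained_origin n w (p : R * R) : unit_square p ->
  exists2 l, l <= 2 & chained (prefix n (lift_seq w p)) (prefix n (lift_seq w (0, 0))) l.
Proof.
move: p => [a b] [/= a01 b01].
pose M : R := 3 ^+ n.+1.
have M0 : 0 < M by exact: exprn_gt0.
have ME : M = (3 ^ n.+1)%:R by rewrite natrX.
have tri1 (c : R) : 0 <= c <= 1 -> triadic n.+1 c c.
  move=> c01; have [||k k3 kc] := @triadic_ex (3 ^ n.+1) M c _ M0.
  - by rewrite expn_gt0.
  - by rewrite -ME divff ?gt_eqF.
  by exists k.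
have move1 (F : R -> R * R) :
    (forall c c', 0 <= c <= 1 -> 0 <= c' <= 1 -> triadic n.+1 c c' ->
      in_common_cell (prefix n (lift_seq w (F c))) (prefix n (lift_seq w (F c')))) ->
    (forall c c', euclid (F c) (F c') = `|c - c'|) ->
    forall c : R, 0 <= c <= 1 ->
    chained (prefix n (lift_seq w (F c))) (prefix n (lift_seq w (F 0))) c.
  move=> Fc Fe c c01.
  have F01 (c' : R) : 0 <= c' <= 1 -> Xn (prefix n (lift_seq w (F c'))).
    by move=> hc; apply: (@common_cell_Xn _ _ (prefix n (lift_seq w (F c')))); apply: Fc => //; exact: tri1.
  suff H K : (K <= 3 ^ n.+1)%N -> forall c' : R, 0 <= c' <= K%:R / M ->
      chained (prefix n (lift_seq w (F c'))) (prefix n (lift_seq w (F 0))) c'.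
    by apply: (H (3 ^ n.+1)%N) => //; rewrite -ME divff ?gt_eqF.
  elim: K => [_ c'|K IH K3 c' /andP[c'0 c'K]].
    rewrite mul0r -eq_le => /eqP <-; apply: chained_refl; apply: F01; lra.
  have [/ltW c'K'|c'K'] := ltP c' (K%:R / M).
    by apply: IH; [exact: ltnW|rewrite c'0].
  have K0 : 0 <= K%:R / M by rewrite divr_ge0 // ltW.
  have K1 : K.+1%:R / M <= 1 by rewrite ler_pdivrMr // mul1r ME ler_nat.
  have E : euclid (F c') (F (K%:R / M)) + K%:R / M = c'.
    by rewrite Fe ger0_norm ?subr_ge0 // subrK.
  rewrite -[X in chained _ _ X]E.
  apply: (@chained_cons _ _ (prefix n (lift_seq w (F (K%:R / M))))).
  - apply: F01; lra.
  - apply: Fc; [lra|lra|]; exists K => //; rewrite -/M; lra.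
  - by apply: IH; [exact: ltnW|lra].
exists (a + b); first lra.
apply: chained_cat.
  apply: (move1 (fun c => (c, b))) => // [c c' c01 c'01 cc'|c c'].
    by apply: lift_cell => //=; exact: tri1.
  exact: euclid_l.
apply: (move1 (fun c => (0, c))) => // [c c' c01 c'01 cc'|c c'].
  by apply: lift_cell => //=; try (split => //=; lra); apply: tri1; lra.
exact: euclid_r.
Qed.

Lemma liftE (x : nat -> pt) : pillow_set x ->
  x = lift_seq (fun i => (x i).2) (proj (x 0%N)).
Proof.
move=> [x1 xS]; apply/funext => i; rewrite /lift_seq.
have -> : iter i T_map (proj (x 0%N)) = proj (x i).
  by elim: i => //= i ->; rewrite xS.
have := (x1 i).2; rewrite /section1 /proj; case: (x i) => p [] //= /(_ isT) -> //.
Qed.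

Lemma lift0 w : lift_seq w (0, 0) = lift_seq (fun=> false) (0, 0).
Proof.
apply/funext => i; rewrite /lift_seq.
have -> : iter i (@T_map R) (0, 0) = (0, 0).
  elim: i => //= i ->; rewrite /T_map /S_map /= mulr0 /fold3 ler01 //.
by rewrite /section1 /in_center /= [3^-1 < 0]ltNge invr_ge0 ler0n /= andbF.
Qed.

Lemma chained_pillow n (x y : nat -> pt) : pillow_set x -> pillow_set y ->
  exists2 l, l <= 4 & chained (prefix n x) (prefix n y) l.
Proof.
move=> Px Py.
have H z : pillow_set z -> exists2 l, l <= 2 &
    chained (prefix n z) (prefix n (lift_seq (fun=> false) (0, 0))) l.
  move=> Pz; rewrite (congr1 (prefix n) (liftE Pz)) -(lift0 (fun i => (z i).2)).
  by apply: chained_origin; exact: (Pz.1 0%N).1.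
have [l l2 xl] := H _ Px; have [l' l'2 yl] := H _ Py.
exists (l + l'); first lra.
apply: chained_cat xl _; apply: chained_sym yl.
apply: prefix_Xn; apply: lift_pillow; exact: unit_square0.
Qed.

Lemma dn_prefixS n (x y : nat -> pt) : pillow_set x -> pillow_set y ->
  dn (prefix n x) (prefix n y) <= dn (prefix n.+1 x) (prefix n.+1 y).
Proof.
move=> Px Py; pose t (z : 'I_n.+2 -> pt) : 'I_n.+1 -> pt :=
  fun i => z (widen_ord (leqnSn n.+1) i).
have tc z z' : in_common_cell z z' -> in_common_cell (t z) (t z').
  move=> [c sc [[[z1 zS] zc] [[z'1 z'S] z'c]]].
  exists (fun i => c (widen_ord (leqnSn n.+1) i)); first by move=> i; exact: sc.
  split; split=> [|i]; try exact: zc; try exact: z'c.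
  - by split=> [i|i j ij]; [exact: z1|exact: zS].
  - by split=> [i|i j ij]; [exact: z'1|exact: z'S].
have t0 z : t z ord0 = z ord0 by congr (z _); exact: val_inj.
apply: dn_ge => [|l xyl].
  by have [l _ xyl] := chained_pillow n.+1 Px Py; exists l.
apply: dn_le; rewrite -[prefix n x]/(t (prefix n.+1 x)).
move: (prefix n.+1 x) l xyl; apply: chained_ind.
  exact/chained_refl/(prefix_Xn n Py).
move=> z z' l Xz zz' _ IH; rewrite -(t0 z) -(t0 z').
by apply: chained_cons (tc _ _ zz') IH; exact: common_cell_Xn (tc _ _ zz').
Qed.

Lemma dn_ge0 n (x y : nat -> pt) : pillow_set x -> pillow_set y ->
  0 <= dn (prefix n x) (prefix n y).
Proof.
move=> Px Py; apply: dn_ge => [|l /chained_ge0//].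
by have [l _ xyl] := chained_pillow n Px Py; exists l.
Qed.

Lemma dn_triangle n (x y z : nat -> pt) :
    pillow_set x -> pillow_set y -> pillow_set z ->
  dn (prefix n x) (prefix n z) <=
  dn (prefix n x) (prefix n y) + dn (prefix n y) (prefix n z).
Proof.
move=> Px Py Pz; rewrite -lerBlDr; apply: dn_ge => [|l xyl].
  by have [l _ xyl] := chained_pillow n Px Py; exists l.
rewrite lerBlDl -lerBlDr; apply: dn_ge => [|l' yzl'].
  by have [l' _ yzl] := chained_pillow n Py Pz; exists l'.
by rewrite lerBlDl addrC; apply: dn_le; rewrite addrC; exact: chained_cat yzl'.
Qed.

Lemma dn_sym n (x y : nat -> pt) : pillow_set x -> pillow_set y ->
  dn (prefix n x) (prefix n y) = dn (prefix n y) (prefix n x).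
Proof.
move=> Px Py; congr inf; apply/seteqP; split => l; apply: chained_sym;
  exact: prefix_Xn.
Qed.

Lemma dn_refl n (x : nat -> pt) : pillow_set x ->
  dn (prefix n x) (prefix n x) = 0.
Proof.
move=> Px; apply/eqP; rewrite eq_le dn_ge0 // andbT.
by apply: dn_le; apply: chained_refl; exact: prefix_Xn.
Qed.

Lemma dn_lip n (f : ('I_n.+1 -> pt) -> R) (x y : nat -> pt) :
  pillow_set x -> pillow_set y ->
  (forall x x', in_common_cell x x' ->
    `|f x - f x'| <= euclid (proj (x ord0)) (proj (x' ord0))) ->
  `|f (prefix n x) - f (prefix n y)| <= dn (prefix n x) (prefix n y).
Proof.
move=> Px Py fl; apply: dn_ge => [|l]; last exact: chained_lip.
by have [l _ xyl] := chained_pillow n Px Py; exists l.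
Qed.

Lemma fold3_lip (s t : R) : `|fold3 s - fold3 t| <= `|s - t|.
Proof.
have := ler_norm (s - t); have := ler_norm (t - s); rewrite (distrC t s).
move: `|s - t| => e ? ?; rewrite ler_norml /fold3.
by do ! case: ifPn; rewrite -?ltNge => *; lra.
Qed.

Definition depth (p : R * R) : R :=
  Num.max 0 (Num.min (Num.min (p.1 - 3^-1) (2 / 3 - p.1))
                     (Num.min (p.2 - 3^-1) (2 / 3 - p.2))).

Definition sdepth (x : pt) : R := if x.2 then - depth x.1 else depth x.1.

Lemma min_lip (a a' b b' e : R) : `|a - a'| <= e -> `|b - b'| <= e ->
  `|Num.min a b - Num.min a' b'| <= e.
Proof.
rewrite !ler_norml => /andP[? ?] /andP[? ?].
by case: (leP a b) => ?; case: (leP a' b') => ?; lra.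
Qed.

Lemma max_lip (a a' e : R) : `|a - a'| <= e ->
  `|Num.max 0 a - Num.max 0 a'| <= e.
Proof.
rewrite !ler_norml => /andP[? ?].
by case: (leP 0 a) => ?; case: (leP 0 a') => ?; lra.
Qed.

Lemma depth_lip p q e : `|p.1 - q.1| <= e -> `|p.2 - q.2| <= e ->
  `|depth p - depth q| <= e.
Proof.
move=> h1 h2; have shift (a b c : R) : `|(a - c) - (b - c)| = `|a - b|.
  by congr Num.norm; ring.
have flip (a b c : R) : `|(c - a) - (c - b)| = `|a - b|.
  by rewrite [RHS]distrC; congr Num.norm; ring.
by apply: max_lip; apply: min_lip; apply: min_lip; rewrite ?shift ?flip.
Qed.

Lemma depth_gt0 p : (0 < depth p) = in_center p.
Proof.
rewrite /depth /in_center lt_max ltxx /= !lt_min !subr_gt0.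
by rewrite -!andbA.
Qed.

Lemma depth_ge0 p : 0 <= depth p.
Proof. by rewrite /depth le_max lexx. Qed.

Lemma sdepth_lip c x y e : squares c -> c x -> c y ->
  `|(proj x).1 - (proj y).1| <= e -> `|(proj x).2 - (proj y).2| <= e ->
  `|sdepth x - sdepth y| <= e.
Proof.
move=> sc cx cy xy1 xy2; have := depth_lip xy1 xy2; rewrite /proj.
case: sc => [cE|[i [j [_ _ cE]]]]; rewrite {}cE in cx cy; last first.
  by rewrite /sdepth cx.2 cy.2.
have H z : second_center z -> sdepth z = - depth z.1.
  move=> [_ z2]; rewrite /sdepth z2; case: ifPn => //.
  by rewrite -depth_gt0 lt_neqAle depth_ge0 andbT negbK => /eqP <-; rewrite oppr0.
rewrite (H _ cx) (H _ cy) -normrN => h; rewrite (_ : - depth x.1 - - depth y.1 = - (depth x.1 - depth y.1)) //; ring.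
Qed.

Lemma cell_proj_lip n (x y : 'I_n.+1 -> pt) (i : 'I_n.+1) : Xn x -> Xn y ->
  let e := 3 ^+ i * euclid (proj (x ord0)) (proj (y ord0)) in
  `|(proj (x i)).1 - (proj (y i)).1| <= e /\
  `|(proj (x i)).2 - (proj (y i)).2| <= e.
Proof.
move=> [_ xS] [_ yS] /=; case: i => i; elim: i => [|i IH] lin.
  have -> : Ordinal lin = ord0 by exact: val_inj.
  by rewrite expr0 mul1r euclidl euclidr.
have [] := IH (ltnW lin).
have E : Ordinal lin = (Ordinal (ltnW lin)).+1 :> nat by [].
rewrite (xS _ _ E) (yS _ _ E) /= => h1 h2.
have H (s t e : R) : `|s - t| <= e -> `|fold3 (3 * s) - fold3 (3 * t)| <= 3 * e.
  move=> st; apply: le_trans (fold3_lip _ _) _.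
  by rewrite -mulrBr normrM ger0_norm // ler_pM2l.
by rewrite exprS -mulrA; split; exact: H.
Qed.

Lemma dn_eq0 (x y : nat -> pt) : pillow_set x -> pillow_set y ->
  (forall n, dn (prefix n x) (prefix n y) = 0) -> x = y.
Proof.
move=> Px Py xy0.
have lip0 n (f : ('I_n.+1 -> pt) -> R) :
    (forall x x', in_common_cell x x' ->
      `|f x - f x'| <= euclid (proj (x ord0)) (proj (x' ord0))) ->
    f (prefix n x) = f (prefix n y).
  move=> /(dn_lip Px Py); rewrite xy0 normr_le0 subr_eq0 => /eqP //.
have tag i : proj (x i) = proj (y i) -> x i = y i.
  move=> pxy.
  have : 3 ^- i * sdepth (x i) = 3 ^- i * sdepth (y i).
    apply: (lip0 i (fun z => 3 ^- i * sdepth (z ord_max))) => z z'.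
    move=> [c sc [[Xz zc] [Xz' z'c]]].
    have [h1 h2] := cell_proj_lip ord_max Xz Xz'.
    have := sdepth_lip (sc ord_max) (zc _) (z'c _) h1 h2.
    by rewrite -mulrBr normrM ger0_norm ?invr_ge0 ?exprn_ge0 // ler_pdivrMl ?exprn_gt0.
  have n3 : (3 ^- i : R) != 0 by rewrite invr_eq0 expf_neq0.
  move=> /(mulfI n3).
  have := (Px.1 i).2; have := (Py.1 i).2; move: pxy; rewrite /proj /sdepth.
  case: (x i) (y i) => [p a] [q b] /= <-; rewrite -depth_gt0.
  case: a; case: b => /= hb ha e //; exfalso; [have h := ha isT|have h := hb isT]; lra.
suff pxy i : proj (x i) = proj (y i) by apply/funext => i; exact: tag.
elim: i => [|i IH]; last by rewrite Px.2 Py.2 (tag _ IH).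
rewrite [LHS]surjective_pairing [RHS]surjective_pairing; congr pair.
- by apply: (lip0 0%N (fun z => (proj (z ord0)).1)) => z z' _; exact: euclidl.
- by apply: (lip0 0%N (fun z => (proj (z ord0)).2)) => z z' _; exact: euclidr.
Qed.

Lemma cvg_dn (x y : pillow R) :
  cvgn (fun n => dn (prefix n (val x)) (prefix n (val y))).
Proof.
have Px := set_mem (valP x); have Py := set_mem (valP y).
apply: nondecreasing_is_cvgn.
  by apply/nondecreasing_seqP => n; exact: dn_prefixS.
exists 4 => _ [n _ <-]; have [l l4 xyl] := chained_pillow n Px Py.
exact: le_trans (dn_le xyl) l4.
Qed.

Lemma d0_cvg (x y : pillow R) :
  dn (prefix n (val x)) (prefix n (val y)) @[n --> \oo] --> d0 x y.
Proof. exact: cvg_dn. Qed.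

Lemma pillowP (x : pillow R) : pillow_set (val x).
Proof. exact: set_mem (valP x). Qed.

Lemma d0xx (x : pillow R) : d0 x x = 0.
Proof.
rewrite /d0 (_ : (fun _ => _) = cst 0); first exact: lim_cst.
by apply/funext => n; apply: dn_refl; exact: pillowP.
Qed.

Lemma d0_sym (x y : pillow R) : d0 x y = d0 y x.
Proof.
congr (lim (_ @ \oo)); apply/funext => n.
by apply: dn_sym; exact: pillowP.
Qed.

Lemma d0_triangle (y x z : pillow R) : d0 x z <= d0 x y + d0 y z.
Proof.
rewrite /d0 -limD; try exact: cvg_dn.
apply: ler_lim; [exact: cvg_dn|exact: (is_cvgD (cvg_dn (x:=x) (y:=y)) (cvg_dn (x:=y) (y:=z)))|].
by apply: nearW => n; apply: dn_triangle; exact: pillowP.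
Qed.

Lemma d0_eq0 (x y : pillow R) : d0 x y = 0 -> x = y.
Proof.
have Px := set_mem (valP x); have Py := set_mem (valP y).
move=> xy0; apply: set_type_val_inj; apply: dn_eq0 => // n.
apply/eqP; rewrite eq_le dn_ge0 // andbT -xy0.
have nd : nondecreasing_seq (fun n => dn (prefix n (val x)) (prefix n (val y))).
  by apply/nondecreasing_seqP => k; exact: dn_prefixS.
exact: nondecreasing_cvgn_le nd (@cvg_dn x y) n.
Qed.

Definition pillow_metric : metric_on R (pillow R) :=
  MetricOn d0xx d0_eq0 d0_sym d0_triangle.

End metric_proof.

Definition sheet_space (R : realType) (w : nat -> bool) : Type := @sheet R w.

Lemma sheet_base (R : realType) (w : nat -> bool) :
  sheet w (sheet_map w (exist (fun p => p \in @unit_square R) (0, 0)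
    (mem_set unit_square0))).
Proof. by eexists. Qed.

HB.instance Definition _ (R : realType) (w : nat -> bool) :=
  gen_eqMixin (sheet_space R w).
HB.instance Definition _ (R : realType) (w : nat -> bool) :=
  gen_choiceMixin (sheet_space R w).
HB.instance Definition _ (R : realType) (w : nat -> bool) :=
  isPointed.Build (sheet_space R w)
    (exist (fun x => x \in sheet w) _ (mem_set (sheet_base R w))).

Definition sheet_metric (R : realType) (w : nat -> bool)
    (d : metric_on R (pillow R)) : metric_on R (sheet_space R w) :=
  restrict_metric (sheet w) d.

(* Main.v *)
Require Import Defs.
From mathcomp Require Import all_boot all_order all_algebra.
From mathcomp Require Import all_classical all_reals all_analysis.
From mathcomp Require Import measurable_realfun.
From mathcomp Require Import ring lra.
Set Implicit Arguments.
Unset Strict Implicit.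
Unset Printing Implicit Defensive.
Import Order.TTheory GRing.Theory Num.Theory.
Import numFieldNormedType.Exports.
Local Open Scope classical_set_scope.
Local Open Scope ring_scope.

(** Let P : X -> Sigma project the pillow space onto the sheet. By the symmetry of
    d_SL, a point x may be moved into the sheet by some iota_w, which does not
    change P; the three points P x, P y and the image of y under the same iota_w
    then satisfy d_0(P x, P y) <= 2 d_0(P x, iota_w y), and quasisymmetry turns this
    into d_SL(P x, P y) <= L d_SL(x, y). So P is Lipschitz, and the measure on the
    sheet is the image nu of mu = H^Q under P.

    The preimage of a ball of the sheet is, up to a bounded factor in the radius,
    the union of the balls of X centred at the points of a fiber, and the isometries
    iota_w permute these balls. Choosing a maximal separated family in the fiber
    compares averages over balls of Sigma with averages over one ball of X, so that
    doubling and the Poincare inequality descend from u o P to u. *)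

(** * Balls, Borel sets and pointwise Lipschitz constants *)

(** The size [N] of the separated family depends on the fiber and on the scale and is never
    estimated, and [nu] is not shown to be Ahlfors regular. The point is that one family bounds
    integrals over balls of the sheet from both sides, so [N] cancels in every ratio of measures and
    in every average; only the growth of [mu] under a change of radius remains. The factor 2 for d_0
    has this origin: on a sheet d_0 is at most the sum of the two coordinate differences of the base
    points, while on X each of these differences is at most d_0. Quasisymmetry also keeps X bounded.
    Hence [mu] is finite, which makes the separated families finite, and X is compact, which makes P
    a closed map and lets the Radon property descend. The Poincare inequality contains the diameter
    of the ball instead of its radius. Balls of the sheet must therefore not be much thinner than
    those of X, and this is where the connectedness of the sheet enters. *)

Section metric_facts.
Context {R : realType}.
Implicit Types (Z W : pmetricType R).

Lemma ball_mdistP Z (x y : Z) r : ball x r y <-> mdist x y < r.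
Proof. by rewrite ballEmdist. Qed.

Lemma open_mdistP Z (A : set Z) :
  open A <-> forall x, A x -> exists2 e : R, 0 < e & forall y, mdist x y < e -> A y.
Proof.
rewrite openE; split => [oA x /oA|oA x /oA [e e0 eA]].
  move=> /metricType_numDomainType.nbhs_mdistP[e /= e0 eA].
  by exists e => // y xy; exact: eA.
by apply/metricType_numDomainType.nbhs_mdistP; exists e.
Qed.

Lemma open_mdist_ball Z (x : Z) r : open (ball x r).
Proof.
apply/open_mdistP => y /ball_mdistP xy; exists (r - mdist x y).
  by rewrite subr_gt0.
move=> z yz; apply/ball_mdistP; apply: le_lt_trans (metric_triangle x y z) _.
by rewrite -ltrBrDl.
Qed.

Lemma measurable_open Z (A : set Z) : open A -> measurable (A : set (borel Z)).
Proof. by move=> oA; exact: sub_sigma_algebra. Qed.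

Lemma measurable_mdist_ball Z (x : Z) r :
  measurable (ball x r : set (borel Z)).
Proof. by apply: measurable_open; exact: open_mdist_ball. Qed.

Lemma continuous_borel_measurable Z W (f : Z -> W) : continuous f ->
  measurable_fun [set: borel Z] (f : borel Z -> borel W).
Proof.
move=> cf; apply: (measurability (@open W : set (set (borel W)))) => // _ [A oA <-].
by rewrite setTI; apply: measurable_open; apply: open_comp oA => x _; exact: cf.
Qed.

Lemma lower_semicontinuous_borel_measurable Z (f : Z -> \bar R) :
  (forall a : R, open [set x | (a%:E < f x)%E]) ->
  measurable_fun [set: borel Z] (f : borel Z -> \bar R).
Proof.
move=> lf; refine (@measurability _ _ (borel Z) (\bar R) setT f _ (ErealGenOInfty.measurableE R) _) => _ [_ [a ->] <-].
rewrite setTI (_ : _ @^-1` _ = [set x | (a%:E < f x)%E]); first exact: measurable_open.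
by apply/seteqP; split => x /=; rewrite in_itv /= andbT.
Qed.

Lemma lipschitz_funP Z (u : Z -> R) : lipschitz_fun u ->
  exists2 L : R, 0 < L & forall x y, `|u x - u y| <= L * mdist x y.
Proof.
move=> [L uL]; exists (Num.max L 1); first by rewrite lt_max ltr01 orbT.
move=> x y; apply: le_trans (uL x y) _.
by rewrite ler_wpM2r ?mdist_ge0 // le_max lexx.
Qed.

Lemma lipschitz_measurable Z (u : Z -> R) : lipschitz_fun u ->
  measurable_fun [set: borel Z] (u : borel Z -> R).
Proof.
move=> /lipschitz_funP[L L0 uL].
refine (@measurability _ _ (borel Z) (measurableTypeR R) setT u _ (RGenOInfty.measurableE R) _) => _ [_ [a ->] <-].
rewrite setTI (_ : _ @^-1` _ = [set x | a < u x]); last first.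
  by apply/seteqP; split => x /=; rewrite in_itv /= andbT.
apply: measurable_open; apply/open_mdistP => x /= ax; exists ((u x - a) / L).
  by rewrite divr_gt0 // subr_gt0.
move=> y; rewrite ltr_pdivlMr // => xy.
have := le_lt_trans (uL x y) _; rewrite mulrC => /(_ _ xy).
by rewrite ltr_norml => /andP[_]; rewrite ltrD2l ltrN2.
Qed.

Definition slope Z (u : Z -> R) (r : R) (x : Z) : \bar R :=
  ereal_sup [set (`|u y - u x| / r)%:E | y in ball x r].

(** The radii [n.+1%:R^-1] are cofinal among the right neighbourhoods of 0, so the upper limit
    becomes a countable infimum, to which measurability passes. *)
Lemma LipE Z (u : Z -> R) x :
  Lip u x = einfs (fun n => ereal_sup [set slope u r x | r in `]0, n.+1%:R^-1[]) 0.
Proof.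
apply/eqP; rewrite eq_le; apply/andP; split.
  apply: le_ereal_inf_tmp => _ [n _ <-]; apply: ereal_inf_lbound.
  exists `]0, n.+1%:R^-1[%classic => //=.
  near=> r; rewrite /= in_itv /=; apply/andP; split.
    by near: r; exact: nbhs_right_gt.
  by near: r; apply: nbhs_right_lt; rewrite invr_gt0.
apply: le_ereal_inf_tmp => _ [V [e /= e0 eV] <-].
have [n ne] : exists n, n.+1%:R^-1 < e.
  exists (Num.truncn e^-1); rewrite -[ltRHS]invrK ltf_pV2 ?posrE ?invr_gt0 //.
  by rewrite truncnS_gt.
apply: ge_ereal_inf => /=.
exists (ereal_sup [set slope u r x | r in `]0, n.+1%:R^-1[]).
  by exists n.
apply: le_ereal_sup => _ [r /= +] <-; rewrite in_itv /= => /andP[r0 rn].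
exists r => //; apply: eV => //=.
by rewrite sub0r normrN gtr0_norm //; exact: lt_trans ne.
Unshelve. all: by end_near. Qed.

(** The ball is open and the denominator is the fixed radius [r]: a point [y] witnessing the strict
    inequality at [x] also witnesses it at every nearby centre. *)
Lemma slope_lsc Z (u : Z -> R) r a : 0 < r -> lipschitz_fun u ->
  open [set x | (a%:E < slope u r x)%E].
Proof.
move=> r0 /lipschitz_funP[L L0 uL]; apply/open_mdistP => x /=.
move=> /ereal_sup_gt[_ [y /ball_mdistP xy <-]]; rewrite lte_fin ltr_pdivlMr // => axy.
(* The first bound keeps [y] in the ball around the new centre, the second keeps the quotient above
   [a]. *)
exists (Num.min (r - mdist x y) ((`|u y - u x| - a * r) / L)).
  by rewrite lt_min subr_gt0 xy divr_gt0 // subr_gt0.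
move=> z; rewrite lt_min ltrBrDl ltr_pdivlMr // => /andP[xyz xz].
apply: (@lt_le_trans _ _ (`|u y - u z| / r)%:E).
  rewrite lte_fin ltr_pdivlMr //.
  have := uL x z; have := ler_distD (u z) (u y) (u x); rewrite (distrC (u z)); lra.
apply: ereal_sup_ubound; exists y => //; apply/ball_mdistP.
by have := metric_triangle z x y; rewrite (metric_sym z x); lra.
Qed.

(** The supremum over uncountably many radii preserves lower semicontinuity, so only the outer
    infimum has to be countable. *)
Lemma Lip_measurable Z (u : Z -> R) : lipschitz_fun u ->
  measurable_fun [set: borel Z] (Lip u : borel Z -> \bar R).
Proof.
move=> uL; rewrite (_ : Lip u = fun x : borel Z =>
    einfs (fun n => ereal_sup [set slope u r (x : Z) | r in `]0, n.+1%:R^-1[]) 0).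
  apply: (@measurable_fun_einfs _ (borel Z) R setT (fun n (x : borel Z) =>
    ereal_sup [set slope u r (x : Z) | r in `]0, n.+1%:R^-1[])) => n.
  apply: lower_semicontinuous_borel_measurable => a.
  rewrite (_ : [set x | _] =
      \bigcup_(r in `]0, n.+1%:R^-1[) [set x | (a%:E < slope u r x)%E]).
    by apply: bigcup_open => r /=; rewrite in_itv /= => /andP[r0 _]; exact: slope_lsc.
  apply/seteqP; split => x /=.
    by move=> /ereal_sup_gt[_ [r rn <-] ar]; exists r.
  by move=> [r rn /= ar]; apply: lt_le_trans ar _; apply: ereal_sup_ubound; exists r.
by apply/funext => x; exact: LipE.
Qed.

Lemma slope_ge0 Z (u : Z -> R) r x : 0 < r -> (0 <= slope u r x)%E.
Proof.
move=> r0; apply: ereal_sup_ubound; exists x.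
  by apply/ball_mdistP; rewrite mdistxx.
by rewrite subrr normr0 mul0r.
Qed.

Lemma Lip_ge0 Z (u : Z -> R) x : (0 <= Lip u x)%E.
Proof.
rewrite LipE; apply: le_ereal_inf_tmp => _ [n _ <-].
apply: le_ereal_sup_tmp; exists (slope u (n.+1%:R^-1 / 2) x).
  exists (n.+1%:R^-1 / 2) => //=; rewrite in_itv /= divr_gt0 // ?invr_gt0 //=.
  by rewrite ltr_pdivrMr // ltr_pMr ?invr_gt0 // ltr1n.
by rewrite slope_ge0 // divr_gt0 // invr_gt0.
Qed.

Lemma Lip_le Z (u : Z -> R) (L : R) x : 0 <= L ->
  (forall x y, `|u x - u y| <= L * mdist x y) -> (Lip u x <= L%:E)%E.
Proof.
move=> L0 uL; rewrite LipE; apply: ge_ereal_inf => /=.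
exists (ereal_sup [set slope u r x | r in `]0, 1%:R^-1[]); first by exists 0%N.
apply: ge_ereal_sup => _ [r /= +] <-; rewrite in_itv /= => /andP[r0 _].
apply: ge_ereal_sup => _ [y /ball_mdistP xy <-].
rewrite lee_fin ler_pdivrMr //; apply: le_trans (uL _ _) _.
by rewrite ler_wpM2l // metric_sym ltW.
Qed.

(** At each scale, [f] maps the ball of radius [r] into the ball of radius [L * r], and passing from
    the denominator [r] to [L * r] costs the factor [L]. *)
Lemma Lip_comp Z W (f : Z -> W) (u : W -> R) (L : R) x : 0 < L ->
  (forall x y, mdist (f x) (f y) <= L * mdist x y) ->
  (Lip (u \o f) x <= L%:E * Lip u (f x))%E.
Proof.
move=> L0 fL; rewrite -lee_pdivrMl //.
rewrite [leRHS]LipE; apply: le_ereal_inf_tmp => _ [n _ <-].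
rewrite lee_pdivrMl // LipE.
have [m mn] : exists m, L * m.+1%:R^-1 < n.+1%:R^-1.
  exists (Num.truncn (L * n.+1%:R)); rewrite ltr_pdivrMr // mulrC ltr_pdivlMr //.
  by rewrite truncnS_gt.
apply: ge_ereal_inf => /=.
exists (ereal_sup [set slope (u \o f) r x | r in `]0, m.+1%:R^-1[]); first by exists m.
apply: ge_ereal_sup => _ [r /= +] <-; rewrite in_itv /= => /andP[r0 rm].
have Lr0 : 0 < L * r by exact: mulr_gt0.
apply: (@le_trans _ _ (L%:E * slope u (L * r) (f x))%E).
  apply: ge_ereal_sup => _ [y /ball_mdistP xy <-].
  rewrite -lee_pdivrMl // -EFinM; apply: ereal_sup_ubound; exists (f y).
    by apply/ball_mdistP; apply: le_lt_trans (fL _ _) _; rewrite ltr_pM2l.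
  by rewrite invfM mulrCA.
rewrite lee_pmul2l // ; apply: ereal_sup_ubound; exists (L * r) => //=.
by rewrite in_itv /= Lr0; apply: lt_trans mn; rewrite ltr_pM2l.
Qed.

End metric_facts.

(** * Separated families *)

Section packing.
Context {R : realType} {Z : pmetricType R}.
Variable mu : {measure set (borel Z) -> \bar R}.
Implicit Types (s : seq Z) (f : Z -> \bar R).

Definition separated (r : R) s := pairwise (fun x y => r <= mdist x y) s.

Definition balls s (r : R) : set (borel Z) := \big[setU/set0]_(z <- s) ball z r.

Lemma ballsP s r y : balls s r y <-> exists2 z, z \in s & mdist z y < r.
Proof.
rewrite /balls; elim: s => [|x s IH].
  by rewrite big_nil; split => // -[].
rewrite big_cons; split => [[/ball_mdistP xy|/IH[z zs zy]]|[z]].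
- by exists x => //; exact: mem_head.
- by exists z => //; rewrite in_cons zs orbT.
rewrite in_cons => /orP[/eqP ->|zs] zy; [left; exact/ball_mdistP|].
by right; apply/IH; exists z.
Qed.

Lemma measurable_balls s r : measurable (balls s r).
Proof.
by apply: bigsetU_measurable => z _; exact: measurable_mdist_ball.
Qed.

Lemma integral_separated_balls s r f :
  separated (2 * r) s -> measurable_fun [set: borel Z] (f : borel Z -> \bar R) ->
  (forall x, 0 <= f x)%E ->
  (\int[mu]_(x in balls s r) f x =
   \sum_(z <- s) \int[mu]_(x in (ball z r : set (borel Z))) f x)%E.
Proof.
move=> + mf f0; elim: s => [_|x s IH].
  by rewrite /balls !big_nil integral_set0.
rewrite /separated /= => /andP[xs ss]; rewrite big_cons -IH //.
rewrite {1}/balls big_cons ge0_integral_setU //.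
- exact: measurable_mdist_ball.
- exact: measurable_balls.
- exact: measurable_funTS.
- apply/disj_setPS => y [/ball_mdistP xy /ballsP[z zs zy]].
  have := allP xs z zs => /=; apply/negP; rewrite -ltNge.
  by have := metric_triangle x y z; rewrite (metric_sym y z); lra.
Qed.

Lemma integral_balls_le s r f :
  measurable_fun [set: borel Z] (f : borel Z -> \bar R) ->
  (forall x, 0 <= f x)%E ->
  (\int[mu]_(x in balls s r) f x <=
   \sum_(z <- s) \int[mu]_(x in (ball z r : set (borel Z))) f x)%E.
Proof.
move=> mf f0; elim: s => [|x s IH]; first by rewrite /balls !big_nil integral_set0.
rewrite {1}/balls !big_cons -/(balls s r).
rewrite -(setDUK (@subsetUl _ (ball x r : set (borel Z)) (balls s r))).
have mB := @measurable_mdist_ball R Z x r; have ms := measurable_balls s r.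
have mD : measurable (((ball x r : set (borel Z)) `|` balls s r) `\` ball x r).
  by apply: measurableD => //; exact: measurableU.
rewrite ge0_integral_setU //; first last.
- by apply/disj_setPS => y [xy []].
- exact: measurable_funTS.
apply: leeD2l; apply: le_trans IH; apply: ge0_subset_integral => //.
  exact: measurable_funTS.
by move=> y [[]].
Qed.

(* The balls of radius [rho] around a separated family are disjoint of measure at
   least [c], so their number is bounded and a largest family exists. *)
Lemma maximal_separated (F : set Z) (rho c : R) : (mu setT < +oo)%E -> 0 < c ->
    (forall z, F z -> c%:E <= mu (ball z rho))%E ->
  exists s, [/\ separated (2 * rho) s, {in s, forall z, F z}
    & forall y, F y -> balls s (2 * rho) y].
Proof.
move=> mufin c0 Fc.
pose P n := `[< exists s, [/\ size s = n, separated (2 * rho) s & {in s, forall z, F z}] >].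
have muE : mu setT = (fine (mu setT))%:E by rewrite fineK // ge0_fin_numE.
have bnd n : P n -> (n <= Num.truncn (fine (mu setT) / c))%N.
  move=> /asboolP[s [<- sep sF]]; rewrite truncn_ge_nat; last by rewrite divr_ge0 ?fine_ge0 // ltW.
  rewrite ler_pdivlMr // -lee_fin -muE.
  have -> : ((size s)%:R * c)%:E = (\sum_(z <- s) c%:E)%E.
    by rewrite sumEFin big_const_seq count_predT iter_addr_0 mulr_natl.
  apply: (@le_trans _ _ (mu (balls s rho))); last first.
    by apply: le_measure; rewrite ?inE //; exact: measurable_balls.
  rewrite -[leRHS]mul1e -integral_cst; last exact: measurable_balls.
  rewrite integral_separated_balls //=.
  rewrite big_seq [leRHS]big_seq; apply: lee_sum => z zs.
  by rewrite integral_cst ?mul1e; [exact/Fc/sF|exact: measurable_mdist_ball].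
have exP : exists n, P n by exists 0%N; apply/asboolP; exists [::].
have [n /asboolP[s [sn sep sF]] nmax] := ex_maxnP exP bnd.
exists s; split => // y Fy; apply: contrapT => sy.
have : P n.+1.
  apply/asboolP; exists (y :: s); split; rewrite /= ?sn //.
    rewrite /separated /= -/(separated (2 * rho) s) sep andbT; apply/allP => z zs.
    by rewrite leNgt; apply/negP => yz; apply: sy; apply/ballsP; exists z; rewrite // metric_sym.
  by move=> z; rewrite in_cons => /orP[/eqP ->//|/sF].
by move=> /nmax; rewrite ltnn.
Qed.

(** An ultrafilter contains one of finitely many balls covering the space, at every radius; it is
    therefore Cauchy. *)
Lemma complete_totally_bounded_compact : complete_metric Z ->
  (forall r : R, 0 < r -> exists s, forall y, balls s r y) ->
  compact [set: Z].
Proof.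
move=> cZ tb; rewrite compact_ultra => F uF _.
suff /cZ cF : cauchy F by exists (lim F).
apply: cauchy_exP => e e0; have [s sP] := tb _ e0.
have : F (balls s e) by rewrite (_ : balls s e = setT); [exact: filterT|by apply/seteqP; split].
rewrite /balls; elim: s {sP} => [|x s IH].
  by rewrite big_nil => /filter_not_empty.
rewrite big_cons => Fs; have [Fx|Fx] := in_ultra_setVsetC (ball x e) uF.
  by exists x.
apply: IH; apply: filterS (filterI Fs Fx) => y [[]//].
Qed.

End packing.

(** * Ahlfors regular spaces *)

Section ahlfors.
Context {R : realType} {Z : pmetricType R}.
Variables (Q : R) (mu : {measure set (borel Z) -> \bar R}).
Hypothesis muE : forall A : set (borel Z), measurable A ->
  mu A = hausdorff Q (A : set Z).
Hypothesis Qreg : ahlfors_regular Z Q.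
Hypothesis Q0 : 0 <= Q.

Lemma mdist_diam (A : set Z) x y : A x -> A y -> ((mdist x y)%:E <= diam A)%E.
Proof.
move=> Ax Ay; rewrite /diam le_max; apply/orP; right.
by apply: ereal_sup_ubound; exists (x, y).
Qed.

Lemma ball_setT (x : Z) r : (2%:E * diam [set: Z] < r%:E)%E -> ball x r = setT.
Proof.
move=> dr; apply/seteqP; split => // y _; apply/ball_mdistP; rewrite -lte_fin.
apply: le_lt_trans dr; have xy := @mdist_diam setT x y I I.
apply: (le_trans xy); rewrite -[leLHS]mul1e; apply: lee_wpmul2r; last by rewrite lee_fin ler1n.
by apply: le_trans xy; rewrite lee_fin mdist_ge0.
Qed.

(** Regularity speaks only of radii up to twice the diameter. Beyond that a ball is the whole space,
    so a larger radius may be replaced by twice the diameter. One factor [C1] in [K] comes from the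
    upper bound and one from the lower bound. *)
Lemma ahlfors_ratio : exists2 K : R, 1 <= K & forall x (r l : R), 0 < r -> 1 <= l ->
  (mu (ball x (l * r)) <= (K * l `^ Q)%:E * mu (ball x r))%E.
Proof.
have [C C0 reg] := Qreg; pose C1 := Num.max C 1.
have C11 : 1 <= C1 by rewrite le_max lexx orbT.
have C10 : 0 < C1 by exact: lt_le_trans C11.
have mub (x : Z) r : mu (ball x r) = hausdorff Q (ball x r).
  by apply: muE; exact: measurable_mdist_ball.
exists (C1 * C1); first by rewrite -[leLHS]mul1r ler_pM.
move=> x r l r0 l1; have l0 : 0 < l by exact: lt_le_trans l1.
have lQ : 1 <= l `^ Q by rewrite -(powRr0 l) ler_powR.
have [rd|rd] := leP r%:E (2%:E * diam [set: Z])%E; last first.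
  apply: (@le_trans _ _ (mu (ball x r))).
    by rewrite (@ball_setT x r) //; apply: le_measure; rewrite ?inE //; exact: measurable_mdist_ball.
  rewrite -[leLHS]mul1e lee_wpmul2r // lee_fin -[leLHS]mul1r ler_pM //.
  by rewrite -[leLHS]mul1r ler_pM.
have lo : ((C1^-1 * r `^ Q)%:E <= mu (ball x r))%E.
  rewrite mub; have /andP[+ _] := reg x r r0 rd; apply: le_trans.
  rewrite lee_fin ler_wpM2r ?powR_ge0 // lef_pV2 ?posrE // le_max lexx //.
suff up : (mu (ball x (l * r)) <= (C1 * (l * r) `^ Q)%:E)%E.
  apply: (le_trans up).
  apply: (@le_trans _ _ ((C1 * C1 * l `^ Q)%:E * (C1^-1 * r `^ Q)%:E)%E).
    rewrite -EFinM lee_fin powRM; [|exact: ltW|exact: ltW].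
    by rewrite -!mulrA (mulrCA (l `^ Q)) mulVKf ?gt_eqF.
  by rewrite lee_wpmul2l // lee_fin !mulr_ge0 ?powR_ge0 // ltW.
have lr0 : 0 < l * r by exact: mulr_gt0.
have up r' : 0 < r' -> (r'%:E <= 2%:E * diam [set: Z])%E -> r' <= l * r ->
    (mu (ball x r') <= (C1 * (l * r) `^ Q)%:E)%E.
  move=> r'0 r'd r'l; rewrite mub; have /andP[_ +] := reg x r' r'0 r'd.
  move=> /le_trans; apply; rewrite lee_fin ler_pM ?powR_ge0 ?le_max ?lexx ?(ltW C0) //.
  by apply: ge0_ler_powR => //; rewrite nnegrE ltW.
have [lrd|lrd] := leP (l * r)%:E (2%:E * diam [set: Z])%E; first exact: up.
have [D dE] : exists D, diam [set: Z] = D%:E.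
  have := mdist_diam (A := setT) (x := x) (y := x) I I; move: lrd.
  case: (diam setT) => [D||]; first by exists D.
    by rewrite mulry gtr0_sg // mul1e.
  by [].
rewrite dE -EFinM in rd lrd; rewrite !lee_fin !lte_fin in rd lrd.
rewrite (_ : ball x (l * r) = ball x (2 * D)).
  by apply: up; [exact: lt_le_trans rd|rewrite dE|exact: ltW].
rewrite ball_setT; last by rewrite dE -EFinM lte_fin.
apply/seteqP; split => // y _; apply/ball_mdistP.
have := mdist_diam (A := setT) (x := x) (y := y) I I; rewrite dE lee_fin; lra.
Qed.

Lemma bounded_finite_measure (D : R) : doubling mu ->
  (forall x y : Z, mdist x y <= D) -> (mu setT < +oo)%E.
Proof.
move=> [muf _] Db; have D1 : 0 < D + 1.
  by have := Db point point; rewrite mdistxx; lra.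
rewrite (_ : setT = ball (point : Z) (D + 1)); first by have /andP[] := muf point _ D1.
by apply/seteqP; split => // y _; apply/ball_mdistP; have := Db point y; lra.
Qed.

(** The lower mass bound is uniform in the centre, so the finite total mass admits only finitely
    many disjoint balls of a given radius; this gives total boundedness. *)
Lemma bounded_ahlfors_compact (D : R) : complete_metric Z -> doubling mu ->
  (forall x y : Z, mdist x y <= D) -> compact [set: Z].
Proof.
move=> cZ dmu Db; have muT := bounded_finite_measure dmu Db.
apply: complete_totally_bounded_compact => // r r0.
have [rd|rd] := leP r%:E (2%:E * diam [set: Z])%E; last first.
  exists [:: point] => y; apply/ballsP; exists point; rewrite ?mem_head //.
  by apply/ball_mdistP; rewrite ball_setT.
have [C C0 reg] := Qreg.
have r2 : 0 < r / 2 by rewrite divr_gt0.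
have [|z _|s [_ _ sP]] := @maximal_separated R Z mu setT (r / 2) (C^-1 * (r / 2) `^ Q) muT.
- by rewrite mulr_gt0 ?invr_gt0 // powR_gt0.
- rewrite muE; last exact: measurable_mdist_ball.
  have rd2 : ((r / 2)%:E <= 2%:E * diam [set: Z])%E.
    by apply: le_trans rd; rewrite lee_fin ler_pdivrMr // ler_peMr ?ler1n // ltW.
  by have /andP[] := reg z _ r2 rd2.
by exists s => y; have := sP y I; rewrite mulrC divfK.
Qed.

End ahlfors.

(** Covers are pulled back along [g] with the same diameters. As [g] is an involution, the same
    inclusion applied to the preimage of [A] gives the converse. *)
Lemma isometric_hausdorff (R : realType) (Z : pmetricType R) (g : Z -> Z) (s : R) :
  (forall x y, mdist (g x) (g y) = mdist x y) -> involutive g ->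
  forall A, hausdorff s (g @^-1` A) = hausdorff s A.
Proof.
move=> gi gg.
have diamg (A : set Z) : diam (g @^-1` A) = diam A.
  congr (maxe 0%E (ereal_sup _)); apply/seteqP; split => _ [[x y] [/= Ax Ay] <-].
    by exists (g x, g y) => //=; rewrite gi.
  by exists (g x, g y) => /=; [split; rewrite /= gg|rewrite gi].
have sub d A : [set (\sum_(i <oo) (diam (F i) `^ s))%E | F in
      [set F : (set Z)^nat | A `<=` \bigcup_i F i /\
       forall i, (diam (F i) <= d%:E)%E]] `<=`
    [set (\sum_(i <oo) (diam (F i) `^ s))%E | F in
      [set F : (set Z)^nat | g @^-1` A `<=` \bigcup_i F i /\
       forall i, (diam (F i) <= d%:E)%E]].
  move=> _ [F [AF dF] <-]; exists (fun i => g @^-1` F i).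
    split=> [x /AF[i _ Fi]|i]; first by exists i.
    by rewrite diamg.
  by under eq_fun do under eq_bigr do rewrite diamg.
move=> A; congr ereal_sup; apply/seteqP.
suff E d : hausdorff_pre s d (g @^-1` A) = hausdorff_pre s d A.
  by split => _ [d d0 <-]; exists d; rewrite // E.
congr ereal_inf; apply/seteqP; split; last exact: sub.
have gA : g @^-1` (g @^-1` A) = A by apply/seteqP; split => x /=; rewrite gg.
by rewrite -[in X in _ `<=` X]gA; exact: sub.
Qed.

(** * Averages *)

Lemma le_poweR (R : realType) (r : R) (x y : \bar R) :
  0 <= r -> (0 <= x)%E -> (x <= y)%E -> (x `^ r <= y `^ r)%E.
Proof.
move=> r0 x0 xy; apply: gt0_ler_poweR => //.
  by rewrite in_itv /= x0 leey.
by rewrite in_itv /= (le_trans x0) // leey.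
Qed.

Section averages.
Context {R : realType} {Z : pmetricType R}.
Variable mu : {measure set (borel Z) -> \bar R}.
Variable B : set Z.
Hypothesis mB : measurable (B : set (borel Z)).
Hypothesis muB : (0 < mu B < +oo)%E.

Lemma measure_fineK : (fine (mu B))%:E = mu B.
Proof. by case/andP: muB => mu0 muy; rewrite fineK // ge0_fin_numE // ltW. Qed.

Lemma fine_measure_gt0 : 0 < fine (mu B).
Proof. by rewrite fine_gt0. Qed.

Lemma average_ge0 (f : Z -> \bar R) : (forall x, 0 <= f x)%E ->
  (0 <= average mu B f)%E.
Proof.
by move=> f0; rewrite /average mule_ge0 //; exact: integral_ge0.
Qed.

Lemma le_average (f g : Z -> \bar R) :
  measurable_fun [set: borel Z] (f : borel Z -> \bar R) ->
  measurable_fun [set: borel Z] (g : borel Z -> \bar R) ->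
  (forall x, 0 <= f x)%E -> (forall x, f x <= g x)%E ->
  (average mu B f <= average mu B g)%E.
Proof.
move=> mf mg f0 fg; rewrite /average lee_wpmul2l //.
by apply: ge0_le_integral => //; exact: measurable_funTS.
Qed.

Lemma averageZl (k : R) (f : Z -> \bar R) : 0 <= k ->
  measurable_fun [set: borel Z] (f : borel Z -> \bar R) ->
  (forall x, 0 <= f x)%E ->
  average mu B (fun x => k%:E * f x)%E = (k%:E * average mu B f)%E.
Proof.
move=> k0 mf f0; rewrite /average ge0_integralZl_EFin //; last exact: measurable_funTS.
by rewrite muleCA.
Qed.

Lemma averageD (f g : Z -> \bar R) :
  measurable_fun [set: borel Z] (f : borel Z -> \bar R) ->
  measurable_fun [set: borel Z] (g : borel Z -> \bar R) ->
  (forall x, 0 <= f x)%E -> (forall x, 0 <= g x)%E ->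
  average mu B (fun x => f x + g x)%E = (average mu B f + average mu B g)%E.
Proof.
move=> mf mg f0 g0; rewrite /average ge0_integralD //; try exact: measurable_funTS.
by rewrite ge0_muleDr //; exact: integral_ge0.
Qed.

Lemma average_cst (k : R) : average mu B (cst k%:E) = k%:E.
Proof.
rewrite /average integral_cst // -[X in (_ * (_ * X))%E]measure_fineK -!EFinM.
by rewrite mulrCA mulVf ?mulr1 // gt_eqF // fine_measure_gt0.
Qed.

(** The average of [u] lies within the mean of [|u - c|] from [c]. The freedom of [c] is what the
    descent needs: there [c] is an average over a ball of X, not over the ball of the sheet. *)
Lemma average_oscillation (u : Z -> R) (c M : R) :
  measurable_fun [set: borel Z] (u : borel Z -> R) ->
  (forall x, `|u x| <= M) ->
  (average mu B (fun y =>
     `|u y - fine (average mu B (fun y => (u y)%:E))|%:E) <=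
   2%:E * average mu B (fun y => `|u y - c|%:E))%E.
Proof.
move=> muu uM; set uB := fine _.
have mabs k : measurable_fun [set: borel Z] ((fun y => `|u y - k|%:E) : borel Z -> \bar R).
  apply/measurable_EFinP; apply: measurableT_comp; first exact: normr_measurable.
  by apply: measurable_funB => //; exact: measurable_cst.
have iu : mu.-integrable (B : set (borel Z)) (EFin \o u).
  apply: measurable_bounded_integrable => //; first by case/andP: muB.
    exact: measurable_funTS.
  by exists M; split; [exact: num_real|move=> k Mk x _; apply: le_trans (uM x) (ltW Mk)].
have cuB : (`|c - uB|%:E <= average mu B (fun y => `|u y - c|%:E))%E.
  have ic : mu.-integrable (B : set (borel Z)) (cst c%:E).
    have mc : measurable_fun (B : set (borel Z)) (cst c : borel Z -> R) by exact: measurable_cst.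
    apply: (measurable_bounded_integrable _ _ mc) => //.
      by case/andP: muB.
    by exists `|c|; split; [exact: num_real|move=> k ck x _ /=; exact: ltW].
  rewrite /average lee_pdivlMl ?fine_measure_gt0 //.
  have [i iE] : exists i : R, (\int[mu]_(x in (B : set (borel Z))) (u x)%:E = i%:E)%E.
    by exists (fine (\int[mu]_(x in (B : set (borel Z))) (u x)%:E)); rewrite fineK // integrable_fin_num.
  have m0 := fine_measure_gt0.
  have -> : uB = (fine (mu B))^-1 * i by rewrite /uB /average iE -EFinM.
  have := le_abse_integral mu mB (measurable_int _ (integrableB mB iu ic)).
  rewrite integralB // iE integral_cst // -measure_fineK -EFinM -EFinB.
  apply: le_trans; rewrite -EFinM lee_fin -{1}(gtr0_norm m0) -normrM.
  by rewrite mulrBr mulVKf ?gt_eqF // distrC mulrC.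
apply: (@le_trans _ _ (average mu B (fun y => `|u y - c|%:E + `|c - uB|%:E)%E)).
  apply: le_average => //.
    by apply: emeasurable_funD => //; exact: measurable_cst.
  by move=> x; rewrite -EFinD lee_fin ler_distD.
rewrite averageD // average_cst (_ : 2%:E = 1%:E + 1%:E)%E // ge0_muleDl ?lee_fin // mul1e.
by rewrite leeD2l.
Qed.

(** Jensen's inequality up to the factor [2 ^ (1/p)]. Splitting at [y = t] gives
    [y^p <= t^p + t^(p-q) * y^q]; averaging, with [t] the q-mean of [f], bounds the p-th moment by
    [2 * t^p]. The bound [M] makes all moments finite. *)
Lemma power_mean (f : Z -> \bar R) (M p q : R) : 0 < p -> p <= q ->
  measurable_fun [set: borel Z] (f : borel Z -> \bar R) ->
  (forall x, 0 <= f x <= M%:E)%E ->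
  ((average mu B (fun x => f x `^ p)) `^ p^-1 <=
   2%:E `^ p^-1 * (average mu B (fun x => f x `^ q)) `^ q^-1)%E.
Proof.
move=> p0 pq mf fM; have q0 : 0 < q by exact: lt_le_trans pq.
have M0 : 0 <= M by have /andP[/le_trans h /h] := fM point; rewrite lee_fin.
have mfp s : measurable_fun [set: borel Z] ((fun x => f x `^ s)%E : borel Z -> \bar R).
  exact: measurableT_comp (measurable_poweR s) mf.
have fin s : 0 < s -> exists2 A : R, 0 <= A & average mu B (fun x => f x `^ s)%E = A%:E.
  move=> s0; have : (average mu B (fun x => f x `^ s) <= (M `^ s)%:E)%E.
    rewrite -(average_cst (M `^ s)); apply: le_average.
    - exact: mfp.
    - exact: measurable_cst.
    - by move=> x; exact: poweR_ge0.
    - move=> x; rewrite -poweR_EFin; have /andP[h0 h1] := fM x.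
      by apply: le_poweR => //; exact: ltW.
  have := @average_ge0 (fun x => f x `^ s)%E (fun x => poweR_ge0 _ _).
  case: average => [A||] //; first by exists A.
have [Ap Ap0 ApE] := fin _ p0; have [Aq Aq0 AqE] := fin _ q0.
rewrite ApE AqE !poweR_EFin -EFinM lee_fin.
have bnd t : 0 < t -> Aq <= t `^ q -> Ap <= 2 * t `^ p.
  move=> t0 At; rewrite -lee_fin -ApE.
  pose c := t `^ p / t `^ q.
  have c0 : 0 <= c by rewrite divr_ge0 ?powR_ge0.
  apply: (@le_trans _ _ (average mu B (fun x => (t `^ p)%:E + c%:E * f x `^ q)%E)).
    apply: le_average.
    - exact: mfp.
    - by apply: emeasurable_funD; [exact: measurable_cst|exact: measurable_funeM].
    - by move=> x; exact: poweR_ge0.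
    move=> x; have /andP[] := fM x; case: (f x) => [y||] // y0 _.
    rewrite !poweR_EFin -EFinM -EFinD lee_fin; rewrite lee_fin in y0.
    have [yt|ty] := leP y t.
      apply: (@le_trans _ _ (t `^ p)); last by rewrite lerDl mulr_ge0 ?powR_ge0.
      by rewrite ge0_ler_powR // ?nnegrE // ltW.
    have yy : 0 < y by exact: lt_trans ty.
    apply: (@le_trans _ _ (c * y `^ q)); last by rewrite lerDr powR_ge0.
    rewrite /c mulrAC ler_pdivlMr ?powR_gt0 //.
    have E z : 0 < z -> z `^ q = z `^ p * z `^ (q - p).
      by move=> z0; rewrite -powRD ?(gt_eqF z0) ?implybT //; congr (_ `^ _); ring.
    rewrite !E // mulrCA ler_pM2l ?powR_gt0 // ler_pM2l ?powR_gt0 //.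
    by rewrite ge0_ler_powR // ?subr_ge0 // ?nnegrE // ltW.
  rewrite averageD //; first last.
  - by move=> x; rewrite mule_ge0 ?poweR_ge0.
  - by move=> x; rewrite lee_fin powR_ge0.
  - exact: measurable_funeM.
  rewrite average_cst averageZl // ?AqE; last by move=> x; exact: poweR_ge0.
  rewrite -EFinM -EFinD lee_fin mulr2n mulrDl mul1r lerD2l /c mulrAC.
  by rewrite ler_pdivrMr ?powR_gt0 // ler_wpM2l ?powR_ge0.
apply/ler_addgt0Pr => e e0.
(* The q-mean may vanish, so a positive term is added, scaled to contribute exactly [e] in the
   end. *)
pose t := Aq `^ q^-1 + e / 2 `^ p^-1.
have h0 : 0 < 2 `^ p^-1 :> R by rewrite powR_gt0.
have t0 : 0 < t by rewrite ltr_wpDl ?powR_ge0 // divr_gt0.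
have q1 : q != 0 by rewrite gt_eqF.
have p1 : p != 0 by rewrite gt_eqF.
have powqK x : 0 <= x -> (x `^ q^-1) `^ q = x.
  by move=> x0; rewrite -powRrM mulVf // powRr1.
have powpK x : 0 <= x -> (x `^ p) `^ p^-1 = x.
  by move=> x0; rewrite -powRrM mulfV // powRr1.
have At : Aq <= t `^ q.
  rewrite -[leLHS](powqK _ Aq0).
  apply: ge0_ler_powR; rewrite ?nnegrE ?powR_ge0 //; [exact: ltW|exact: ltW|].
  by rewrite lerDl divr_ge0 // ltW.
apply: (@le_trans _ _ ((2 * t `^ p) `^ p^-1)).
  apply: ge0_ler_powR; rewrite ?nnegrE ?mulr_ge0 ?powR_ge0 //.
    by rewrite invr_ge0 ltW.
  exact: bnd.
rewrite powRM ?powR_ge0 // powpK; last exact: ltW.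
by rewrite /t mulrDr mulrCA divff ?mulr1 // gt_eqF.
Qed.
End averages.

(** * Folding by isometries *)

Section fold.
Context {R : realType} {X Z : pmetricType R}.
Variables (P : X -> Z) (j : Z -> X) (L : R).
Hypothesis L1 : 1 <= L.
Hypothesis P_lip : forall x y, mdist (P x) (P y) <= L * mdist x y.
Hypothesis j_iso : forall a b, mdist (j a) (j b) = mdist a b.
Hypothesis jK : forall a, P (j a) = a.
Variable mu : {measure set (borel X) -> \bar R}.
Hypothesis mufin : (mu setT < +oo)%E.
Hypothesis mu_doubling : doubling mu.
Hypothesis fiber_sym : forall x, exists g : X -> X,
  [/\ involutive g, forall y z, mdist (g y) (g z) = mdist y z, forall y, P (g y) = P y,
      forall A, measurable (A : set (borel X)) ->
        mu (g @^-1` A : set (borel X)) = mu A & g x = j (P x)].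
Variable nu : {measure set (borel Z) -> \bar R}.
Hypothesis nuE : forall A : set (borel Z), nu A = mu (P @^-1` A).

Let L0 : 0 < L. Proof. exact: lt_le_trans L1. Qed.

Lemma lipschitz_continuous (Y W : pmetricType R) (f : Y -> W) (M : R) : 0 < M ->
  (forall x y, mdist (f x) (f y) <= M * mdist x y) -> continuous f.
Proof.
move=> M0 fM x; apply/metricType_numDomainType.cvgrPdist_lt => e e0.
near=> y; apply: le_lt_trans (fM x y) _; rewrite mulrC -ltr_pdivlMr //.
near: y; apply: metricType_numDomainType.cvgr_dist_lt; last by rewrite divr_gt0.
exact: cvg_id.
Unshelve. all: by end_near. Qed.

Lemma fold_continuous : continuous P.
Proof. exact: lipschitz_continuous P_lip. Qed.

Lemma fold_measurable : measurable_fun [set: borel X] (P : borel X -> borel Z).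
Proof. by apply: continuous_borel_measurable; exact: fold_continuous. Qed.

Lemma integral_fold (B : set Z) (f : Z -> \bar R) : measurable (B : set (borel Z)) ->
  measurable_fun [set: borel Z] (f : borel Z -> \bar R) ->
  (forall x, 0 <= f x)%E ->
  (\int[nu]_(x in (B : set (borel Z))) f x =
   \int[mu]_(x in (P @^-1` B : set (borel X))) f (P x))%E.
Proof.
move=> mB mf f0.
rewrite -(ge0_integral_pushforward fold_measurable) //; last exact: measurable_funTS.
by congr (integral _ _ _); apply/funext => A; rewrite nuE.
Qed.

(** The isometry [g] carries one ball onto the other and preserves both [mu] and P, so functions
    that factor through P do not distinguish the points of a fiber. *)
Lemma integral_fiber_ball (f : Z -> \bar R) x r :
  measurable_fun [set: borel Z] (f : borel Z -> \bar R) ->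
  (forall x, 0 <= f x)%E ->
  (\int[mu]_(y in (ball x r : set (borel X))) f (P y) =
   \int[mu]_(y in (ball (j (P x)) r : set (borel X))) f (P y))%E.
Proof.
move=> mf f0; have [g [_ gi Pg gmu <-]] := fiber_sym x.
have mg : measurable_fun [set: borel X] (g : borel X -> borel X).
  apply: continuous_borel_measurable; apply: (@lipschitz_continuous _ _ _ 1) => // y z.
  by rewrite gi mul1r.
have mfP : measurable_fun [set: borel X] ((f \o P) : borel X -> \bar R).
  exact: measurableT_comp mf fold_measurable.
have mb := @measurable_mdist_ball R X.
transitivity (\int[pushforward mu (g : borel X -> borel X)]_(y in
    (ball (g x) r : set (borel X))) (f \o P) y)%E.
  rewrite (ge0_integral_pushforward mg);
    [|exact: mb|exact: measurable_funTS|by move=> y _; exact: f0].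
  rewrite (_ : _ @^-1` _ = (ball x r : set (borel X))); last first.
    by apply/seteqP; split => y /ball_mdistP; rewrite ?gi => ?; apply/ball_mdistP; rewrite ?gi.
  by congr (integral _ _ _); apply/funext => y; rewrite /= Pg.
by apply: (eq_measure_integral mu (m1 := measure_function_pushforward__canonical__measure_function_Measure mu mg)) => A mA _; exact: gmu.
Qed.

(* The fiber over [a] is covered by [N] balls of radius [2 * rho] whose
   concentric balls of radius [rho] are disjoint. *)
Lemma fold_compare (a : Z) (rho : R) : 0 < rho ->
  exists2 N : R, 0 < N & forall f : Z -> \bar R,
    measurable_fun [set: borel Z] (f : borel Z -> \bar R) ->
    (forall x, 0 <= f x)%E ->
    (forall s, \int[nu]_(x in (ball a s : set (borel Z))) f x <=
      N%:E * \int[mu]_(x in (ball (j a) (s + 2 * rho) : set (borel X))) f (P x))%E /\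
    (N%:E * \int[mu]_(x in (ball (j a) rho : set (borel X))) f (P x) <=
     \int[nu]_(x in (ball a (L * rho) : set (borel Z))) f x)%E.
Proof.
move=> rho0; have [muf _] := mu_doubling.
have m0 : measurable_fun [set: borel Z] (cst 1%E : borel Z -> \bar R) by [].
have muball (z : X) : mu (ball z rho) = mu (ball (j (P z)) rho).
  have mb z' := @measurable_mdist_ball R X z' rho.
  have := @integral_fiber_ball (cst 1%E) z rho m0 (fun=> lee01).
  by rewrite /= !integral_cst // !mul1e.
have /andP[mua0 muay] := muf (j a) _ rho0.
have muaE : mu (ball (j a) rho) = (fine (mu (ball (j a) rho)))%:E.
  by rewrite fineK // ge0_fin_numE // ltW.
have [||s [sep sa cov]] := @maximal_separated R X mu (P @^-1` [set a]) rho
    (fine (mu (ball (j a) rho))) mufin.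
- by apply: fine_gt0; rewrite mua0.
- by move=> z /= Pz; rewrite -muaE (muball z) Pz.
exists (size s)%:R.
  have := cov (j a) (jK a); move/ballsP => [z zs _].
  by rewrite ltr0n; case: (s) zs.
move=> f mf f0.
have mfP : measurable_fun [set: borel X] ((f \o P) : borel X -> \bar R).
  exact: measurableT_comp mf fold_measurable.
have sumE r : (\sum_(z <- s) \int[mu]_(x in (ball z r : set (borel X))) f (P x) =
    (size s)%:R%:E * \int[mu]_(x in (ball (j a) r : set (borel X))) f (P x))%E.
  transitivity (\sum_(z <- s) \int[mu]_(x in (ball (j a) r : set (borel X))) f (P x))%E.
    by rewrite big_seq [RHS]big_seq; apply: eq_bigr => z /sa /= za; rewrite integral_fiber_ball // za.
  by rewrite big_const_seq count_predT iter_addr_0 mule_natl.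
have mb (x : Z) r := @measurable_mdist_ball R Z x r.
have mPb (x : Z) r : measurable (P @^-1` ball x r : set (borel X)).
  by rewrite -[X in measurable X]setTI; apply: fold_measurable.
split=> [r|].
  rewrite integral_fold // -sumE.
  apply: le_trans (integral_balls_le _ _ _ mfP _); last by move=> x; exact: f0.
  apply: ge0_subset_integral => //; first exact: measurable_balls.
    exact: measurable_funTS.
  (* As [g] is an isometric involution with [g y = j (P y)], the point [g (j a)] of the fiber over
     [a] is as far from [y] as [a] is from [P y]. *)
  move=> y /ball_mdistP ay; have [g [gK gi Pg _ gy]] := fiber_sym y.
  have /ballsP[z zs zj] : balls s (2 * rho) (g (j a)) by apply: cov; rewrite /= Pg jK.
  apply/ballsP; exists z => //; have := metric_triangle z (g (j a)) y.
  by rewrite -[mdist (g _) y]gi gK gy j_iso; lra.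
rewrite integral_fold // -sumE -(integral_separated_balls mu sep mfP); last by move=> x; exact: f0.
apply: ge0_subset_integral => //; first exact: measurable_balls.
  exact: measurable_funTS.
  by move=> y _; exact: f0.
move=> y /ballsP[z /sa /= za zy]; apply/ball_mdistP; rewrite -za.
by apply: le_lt_trans (P_lip _ _) _; rewrite ltr_pM2l.
Qed.

(** * Doubling and comparison of averages *)

Variables (Q K : R).
Hypothesis Q0 : 0 <= Q.
Hypothesis K1 : 1 <= K.
Hypothesis mu_ratio : forall x (r l : R), 0 < r -> 1 <= l ->
  (mu (ball x (l * r)) <= (K * l `^ Q)%:E * mu (ball x r))%E.

Lemma fold_ball_finite (a : Z) r : 0 < r -> (0 < nu (ball a r) < +oo)%E.
Proof.
move=> r0; rewrite nuE; have [muf _] := mu_doubling.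
have mP : measurable (P @^-1` ball a r : set (borel X)).
  rewrite -[X in measurable X]setTI; apply: fold_measurable => //.
  exact: measurable_mdist_ball.
have rL : 0 < r / L by rewrite divr_gt0.
apply/andP; split; last first.
  by apply: le_lt_trans mufin; apply: le_measure; rewrite ?inE.
have /andP[h _] := muf (j a) _ rL; apply: (lt_le_trans h).
apply: le_measure; rewrite ?inE //; first exact: measurable_mdist_ball.
move=> y /ball_mdistP jy; apply/ball_mdistP; rewrite -(jK a).
by apply: le_lt_trans (P_lip _ _) _; rewrite mulrC -ltr_pdivlMr.
Qed.

(** The same [N] serves for [f] and for the constant 1, that is, for integrals and for masses; hence
    it cancels in averages. *)
Lemma fold_ball_compare (a : Z) (rho : R) : 0 < rho ->
  exists2 N : R, 0 < N & forall f : Z -> \bar R,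
    measurable_fun [set: borel Z] (f : borel Z -> \bar R) ->
    (forall x, 0 <= f x)%E ->
    [/\ forall s, (\int[nu]_(x in (ball a s : set (borel Z))) f x <=
      N%:E * \int[mu]_(x in (ball (j a) (s + 2 * rho) : set (borel X))) f (P x))%E,
    (N%:E * \int[mu]_(x in (ball (j a) rho : set (borel X))) f (P x) <=
     \int[nu]_(x in (ball a (L * rho) : set (borel Z))) f x)%E,
    forall s, (nu (ball a s) <= N%:E * mu (ball (j a) (s + 2 * rho)))%E &
    (N%:E * mu (ball (j a) rho) <= nu (ball a (L * rho)))%E].
Proof.
move=> rho0; have [N N0 NP] := fold_compare a rho0; exists N => // f mf f0.
have [h1 h2] := NP f mf f0.
have m0 : measurable_fun [set: borel Z] (cst 1%E : borel Z -> \bar R) by [].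
have [h3 h4] := NP (cst 1%E) m0 (fun=> lee01).
have mX (x : X) r := @measurable_mdist_ball R X x r.
have mZ (x : Z) r := @measurable_mdist_ball R Z x r.
split => // [s|].
  by have := h3 s; rewrite !integral_cst // !mul1e.
by move: h4; rewrite !integral_cst // !mul1e.
Qed.

(** With the scale [r / L] the lower bound is over the ball of radius [r] itself, and the upper
    radius [2 * r + 2 * (r / L)] is at most [4 * L] times that scale. *)
Lemma fold_doubling : doubling nu.
Proof.
split; first exact: fold_ball_finite.
exists (K * (4 * L) `^ Q) => a r r0.
have rL : 0 < r / L by rewrite divr_gt0.
have [N N0 NP] := fold_ball_compare a rL.
have [_ _ h1 h2] := NP (cst 1%E) (measurable_cst _) (fun=> lee01).
apply: (le_trans (h1 _)).
have LrL : L * (r / L) = r by rewrite mulrC divfK // gt_eqF.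
rewrite LrL in h2.
have C0 : 0 <= K * (4 * L) `^ Q by rewrite mulr_ge0 ?powR_ge0 // (le_trans _ K1).
apply: (@le_trans _ _ ((K * (4 * L) `^ Q)%:E * (N%:E * mu (ball (j a) (r / L))))%E); last first.
  by rewrite lee_wpmul2l.
rewrite muleCA; apply: lee_wpmul2l; first by rewrite lee_fin ltW.
apply: (@le_trans _ _ (mu (ball (j a) (4 * L * (r / L))))); last first.
  by apply: mu_ratio => //; have := L1; lra.
apply: le_measure; rewrite ?inE; try exact: measurable_mdist_ball.
move=> y /ball_mdistP jy; apply/ball_mdistP; apply: (lt_le_trans jy).
rewrite -mulrA LrL.
have : r / L <= r by rewrite ler_pdivrMr // ler_peMr // ltW.
lra.
Qed.

(** The scale is again [r / L]. The enlarged radius [r + 2 * (r / L)] is at most [3 * r], which is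
    [3 * L] times the scale. *)
Lemma fold_average_le (a : Z) r (f : Z -> \bar R) : 0 < r ->
  measurable_fun [set: borel Z] (f : borel Z -> \bar R) ->
  (forall x, 0 <= f x)%E ->
  (average nu (ball a r) f <=
   (K * (3 * L) `^ Q)%:E * average mu (ball (j a) (3 * r)) (f \o P))%E.
Proof.
move=> r0 mf f0; have rL : 0 < r / L by rewrite divr_gt0.
have [N N0 NP] := fold_ball_compare a rL.
have [h1 _ _ h2] := NP f mf f0.
have LrL : L * (r / L) = r by rewrite mulrC divfK // gt_eqF.
rewrite LrL in h2.
have r3 : 0 < 3 * r by lra.
have nuB := fold_ball_finite a r0; have [muf _] := mu_doubling.
have muB := muf (j a) _ r3; have muB' := muf (j a) _ rL.
have mfP : measurable_fun [set: borel X] ((f \o P) : borel X -> \bar R).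
  exact: measurableT_comp mf fold_measurable.
have mX (x : X) s := @measurable_mdist_ball R X x s.
have n0 := fine_measure_gt0 nuB; have m0 := fine_measure_gt0 muB.
have m'0 := fine_measure_gt0 muB'.
rewrite /average lee_pdivrMl //.
apply: (le_trans (h1 _)).
apply: (@le_trans _ _ (N%:E * \int[mu]_(x in (ball (j a) (3 * r) : set (borel X))) f (P x))%E).
  apply: lee_wpmul2l; first by rewrite lee_fin ltW.
  apply: ge0_subset_integral => //; first exact: measurable_funTS.
  move=> y /ball_mdistP jy; apply/ball_mdistP; apply: (lt_le_trans jy).
  have : r / L <= r by rewrite ler_pdivrMr // ler_peMr // ltW.
  lra.
rewrite !muleA -!EFinM; apply: lee_wpmul2r; first by apply: integral_ge0 => x _; exact: f0.
rewrite lee_fin mulrA ler_pdivlMr //.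
have e1 : N * fine (mu (ball (j a) (r / L))) <= fine (nu (ball a r)).
  by rewrite -lee_fin EFinM !measure_fineK.
have e2 : fine (mu (ball (j a) (3 * r))) <= K * (3 * L) `^ Q * fine (mu (ball (j a) (r / L))).
  rewrite -lee_fin EFinM !measure_fineK //.
  rewrite (_ : 3 * r = 3 * L * (r / L)); last by rewrite -mulrA LrL.
  by apply: mu_ratio => //; have := L1; lra.
have C0 : 0 <= K * (3 * L) `^ Q by rewrite mulr_ge0 ?powR_ge0 // (le_trans _ K1).
apply: (@le_trans _ _ (N * (K * (3 * L) `^ Q * fine (mu (ball (j a) (r / L)))))).
  by rewrite ler_wpM2l // ltW.
by have := ler_wpM2l C0 e1; lra.
Qed.

(** The constant compares the radius [s + 2 * rho], needed to cover the preimage of [ball a s], with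
    the radius [rho]. *)
Lemma fold_average_ge (a : Z) rho s (f : Z -> \bar R) : 0 < rho -> L * rho <= s ->
  measurable_fun [set: borel Z] (f : borel Z -> \bar R) ->
  (forall x, 0 <= f x)%E ->
  (average mu (ball (j a) rho) (f \o P) <=
   (K * (s / rho + 2) `^ Q)%:E * average nu (ball a s) f)%E.
Proof.
move=> rho0 Ls mf f0.
have [N N0 NP] := fold_ball_compare a rho0.
have [_ h1 h2 _] := NP f mf f0.
have s0 : 0 < s by apply: lt_le_trans Ls; rewrite mulr_gt0.
have nuB := fold_ball_finite a s0; have [muf _] := mu_doubling.
have muB := muf (j a) _ rho0.
have mZ (x : Z) r := @measurable_mdist_ball R Z x r.
have n0 := fine_measure_gt0 nuB; have m0 := fine_measure_gt0 muB.
have C0 : 0 <= K * (s / rho + 2) `^ Q by rewrite mulr_ge0 ?powR_ge0 // (le_trans _ K1).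
rewrite -lee_pdivlMl // in h1.
rewrite /average lee_pdivrMl //; apply: (le_trans h1).
apply: (@le_trans _ _ (N^-1%:E * \int[nu]_(x in (ball a s : set (borel Z))) f x)%E).
  apply: lee_wpmul2l; first by rewrite lee_fin invr_ge0 ltW.
  apply: ge0_subset_integral => //; first exact: measurable_funTS.
  move=> y /ball_mdistP jy; apply/ball_mdistP; exact: lt_le_trans Ls.
rewrite !muleA -!EFinM; apply: lee_wpmul2r; first by apply: integral_ge0 => x _; exact: f0.
rewrite lee_fin ler_pdivlMr // ler_pdivrMl //.
rewrite -lee_fin measure_fineK //; apply: (le_trans (h2 s)).
rewrite [leRHS]EFinM; apply: lee_wpmul2l; first by rewrite lee_fin ltW.
rewrite EFinM measure_fineK // muleC.
rewrite (_ : s + 2 * rho = (s / rho + 2) * rho); last by rewrite [RHS]mulrDl divfK // gt_eqF.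
by apply: mu_ratio => //; rewrite ler_wpDl // ?ler1n // divr_ge0 // ltW.
Qed.

(** * Compactness and the Radon property of the image measure *)

Hypothesis cX : compact [set: X].
Hypothesis mu_radon : radon mu.

Lemma fold_compact : compact [set: Z].
Proof.
rewrite (_ : setT = P @` setT).
  by apply: continuous_compact => //; apply: continuous_subspaceT; exact: fold_continuous.
by apply/seteqP; split => // a _; exists (j a).
Qed.

Lemma closed_borel_measurable (W : pmetricType R) (A : set W) : closed A ->
  measurable (A : set (borel W)).
Proof.
by move=> cA; rewrite -[A]setCK; apply: measurableC; apply: measurable_open; exact: closed_openC.
Qed.

Lemma compact_borel_measurable (W : pmetricType R) (A : set W) : compact A ->
  measurable (A : set (borel W)).
Proof.
by move=> cA; apply: closed_borel_measurable; apply: compact_closed => //; exact: metric_hausdorff.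
Qed.

Lemma fold_preimage_measurable (A : set Z) : measurable (A : set (borel Z)) ->
  measurable (P @^-1` A : set (borel X)).
Proof. by move=> mA; rewrite -[X in measurable X]setTI; exact: fold_measurable. Qed.

Lemma fold_image_compact (A : set X) : closed A -> compact (P @` A).
Proof.
move=> cA; apply: continuous_compact.
  by apply: continuous_subspaceT; exact: fold_continuous.
exact: subclosed_compact cA cX _.
Qed.

Lemma fold_radon : radon nu.
Proof.
have [_ outer inner] := mu_radon.
split.
- move=> A cA; rewrite nuE; apply: le_lt_trans mufin; apply: le_measure; rewrite ?inE //.
  by apply: fold_preimage_measurable; exact: compact_borel_measurable.
- move=> A mA; have mPA := fold_preimage_measurable mA.
  apply/eqP; rewrite eq_le; apply/andP; split.
    apply: le_ereal_inf_tmp => _ [U [oU AU] <-].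
    by apply: le_measure; rewrite ?inE //; exact: measurable_open.
  rewrite nuE outer //; apply: le_ereal_inf_tmp => _ [W [oW AW] <-].
  (* [V] is the largest set whose preimage lies in [W]; it is open because P is a closed map. *)
  pose V := ~` (P @` (~` W)).
  have oV : open V.
    apply: closed_openC; apply: compact_closed; first exact: metric_hausdorff.
    by apply: fold_image_compact; exact: open_closedC.
  have AV : A `<=` V by move=> a Aa [x Wx Pxa]; apply: Wx; apply: AW; rewrite /= Pxa.
  apply: ge_ereal_inf; exists (nu V); first by exists V.
  rewrite nuE; apply: le_measure; rewrite ?inE.
  + by apply: fold_preimage_measurable; exact: measurable_open.
  + exact: measurable_open.
  by move=> x Vx; apply: contrapT => Wx; apply: Vx; exists x.
- move=> U oU; have oPU : open (P @^-1` U).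
    by apply: open_comp oU => x _; exact: fold_continuous.
  apply/eqP; rewrite eq_le; apply/andP; split; last first.
    apply: ge_ereal_sup => _ [A [cA AU] <-]; apply: le_measure; rewrite ?inE //.
      exact: compact_borel_measurable.
    exact: measurable_open.
  rewrite nuE inner //; apply: ge_ereal_sup => _ [A [cA AU] <-].
  have cPA : compact (P @` A).
    apply: fold_image_compact; apply: compact_closed => //; exact: metric_hausdorff.
  (* The image of [A] is compact inside [U], and its preimage contains [A]. *)
  apply: le_ereal_sup_tmp; exists (nu (P @` A)).
    by exists (P @` A) => //; split => // _ [x Ax <-]; exact: AU.
  rewrite nuE; apply: le_measure; rewrite ?inE.
  + exact: compact_borel_measurable.
  + by apply: fold_preimage_measurable; exact: compact_borel_measurable.
  by move=> x Ax; exists x.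
Qed.

(** * Diameters of balls and the Poincare inequality on the sheet *)

Variable D : R.
Hypothesis X_bounded : forall x y : X, mdist x y <= D.
Hypothesis Z_connected : connected [set: Z].
Variables z0 z1 : Z.
Hypothesis z01 : z0 <> z1.

(** If the annulus were empty, [ball a s] would be open and closed, hence everything, although [y]
    lies outside. *)
Lemma connected_annulus (a y : Z) (s t : R) : 0 < s -> s < t -> t <= mdist a y ->
  exists z, s <= mdist a z < t.
Proof.
move=> s0 st aty; apply: contrapT => none.
have sE z : mdist a z < t -> mdist a z < s.
  by move=> zt; rewrite ltNge; apply/negP => sz; apply: none; exists z; rewrite sz.
have : ball a s = setT.
  apply: Z_connected.
  - by exists a; apply/ball_mdistP; rewrite mdistxx.
  - by exists (ball a s); [exact: open_mdist_ball|rewrite setTI].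
  exists (ball a s); last by rewrite setTI.
  rewrite -[ball a s]setCK; apply: open_closedC; apply/open_mdistP => z zs.
  exists (t - s); first by rewrite subr_gt0.
  move=> w zw /ball_mdistP aw; apply: zs; apply/ball_mdistP; apply: sE.
  by have := metric_triangle a w z; rewrite (metric_sym w z); lra.
move=> /seteqP[_ /(_ y I)/ball_mdistP]; rewrite ltNge => /negP; apply; exact: ltW (lt_le_trans st aty).
Qed.

Lemma diam_ball_le (W : pmetricType R) (x : W) r : 0 <= r -> (diam (ball x r) <= (2 * r)%:E)%E.
Proof.
move=> r0; rewrite /diam ge_max lee_fin mulr_ge0 //=.
apply: ge_ereal_sup => _ [[y z] [/ball_mdistP xy /ball_mdistP xz] <-] /=; rewrite lee_fin.
by have := metric_triangle y x z; rewrite (metric_sym y x); move: xy xz => /=; lra.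
Qed.

Lemma fold_diam : exists2 M : R, 1 <= M & forall a r, 0 < r ->
  (diam (ball (j a) (3 * r)) <= M%:E * diam (ball a r))%E.
Proof.
have d0 : 0 < mdist z0 z1 by rewrite mdist_gt0; exact/eqP.
have D0 : 0 <= D by apply: le_trans (X_bounded point point); exact: mdist_ge0.
(* The 6 serves balls that miss a point, whose diameter is at least [r]. The quotient serves balls
   equal to the whole space, whose diameter is at least [mdist z0 z1]. *)
exists (6 + D / mdist z0 z1); first by have := divr_ge0 D0 (ltW d0); lra.
move=> a r r0; have M0 := divr_ge0 D0 (ltW d0).
have [[y ay]|none] := pselect (exists y, r <= mdist a y).
  apply: (@le_trans _ _ ((6 + D / mdist z0 z1) * r)%:E).
    apply: le_trans (diam_ball_le _ _) _; first lra.
    by rewrite lee_fin; have := mulr_ge0 M0 (ltW r0); lra.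
  rewrite EFinM lee_wpmul2l ?lee_fin //; first lra.
  (* Balls are open and may contain no point at distance exactly [r] from the centre, so the
     diameter is reached only up to [e]. *)
  apply/lee_addgt0Pr => e e0.
  have [er|re] := ltP e r; last first.
    apply: (@le_trans _ _ e%:E); first by rewrite lee_fin.
    by rewrite leeDr // /diam le_max lexx.
  have [||z /andP[z1' z2']] := @connected_annulus a y (r - e) r _ _ ay; [lra|lra|].
  rewrite -leeBlDr // -EFinB; apply: (@le_trans _ _ (mdist a z)%:E); first by rewrite lee_fin.
  by apply: mdist_diam; apply/ball_mdistP => //; rewrite mdistxx.
have allb z : ball a r z.
  by apply/ball_mdistP; rewrite ltNge; apply/negP => az; apply: none; exists z.
apply: (@le_trans _ _ ((6 + D / mdist z0 z1) * mdist z0 z1)%:E); last first.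
  rewrite EFinM lee_wpmul2l ?lee_fin //; first lra.
  exact: mdist_diam.
apply: (@le_trans _ _ D%:E).
  rewrite /diam ge_max lee_fin D0 /=; apply: ge_ereal_sup => _ [[x y] _ <-] /=.
  by rewrite lee_fin X_bounded.
by rewrite lee_fin mulrDl divfK ?gt_eqF // lerDr mulr_ge0 // ltW.
Qed.

Variable p : R.
Hypothesis p1 : 1 <= p.
Hypothesis mu_poincare : poincare mu p.

(** The exponent is raised from [p] to [q] while still on X. The comparison constant of the two
    averages then enters only with the power [1/q], which tames its growth in [s / rho]. *)
Lemma fold_Lip_average (a : Z) (u : Z -> R) (q rho s : R) :
  lipschitz_fun u -> p <= q -> 0 < rho -> L * rho <= s ->
  ((average mu (ball (j a) rho) (fun x => Lip (u \o P) x `^ p)) `^ p^-1 <=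
   (2 * ((K * (s / rho + 2) `^ Q) `^ q^-1 * L))%:E *
   (average nu (ball a s) (fun z => Lip u z `^ q)) `^ q^-1)%E.
Proof.
move=> uLip pq rho0 Ls; have [M M0 uM] := lipschitz_funP uLip.
have p0 : 0 < p by exact: lt_le_trans p1.
have q0 : 0 < q by exact: lt_le_trans pq.
have [muf _] := mu_doubling; have muB := muf (j a) _ rho0.
have s0 : 0 < s by apply: lt_le_trans Ls; rewrite mulr_gt0.
have nuB := fold_ball_finite a s0.
have mX := @measurable_mdist_ball R X (j a) rho.
have mZ := @measurable_mdist_ball R Z a s.
have mL := Lip_measurable uLip.
have mLv : measurable_fun [set: borel X] (Lip (u \o P) : borel X -> \bar R).
  apply: Lip_measurable; exists (M * L) => x y; apply: le_trans (uM _ _) _.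
  by rewrite -mulrA ler_wpM2l // ltW.
pose g z := (L%:E * Lip u z)%E.
have g0 z : (0 <= g z)%E by rewrite mule_ge0 ?Lip_ge0 // lee_fin ltW.
have mg : measurable_fun [set: borel Z] (g : borel Z -> \bar R) by exact: measurable_funeM.
have mgP : measurable_fun [set: borel X] ((g \o P) : borel X -> \bar R).
  exact: measurableT_comp mg fold_measurable.
have mpow (W : pmetricType R) (f : W -> \bar R) t :
    measurable_fun [set: borel W] (f : borel W -> \bar R) ->
    measurable_fun [set: borel W] ((fun x => f x `^ t)%E : borel W -> \bar R).
  by move=> mf; exact: measurableT_comp (measurable_poweR t) mf.
apply: (@le_trans _ _ ((average mu (ball (j a) rho) (fun x => (g \o P) x `^ p)) `^ p^-1)%E).
  apply: le_poweR; first by rewrite invr_ge0 ltW.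
    by apply: average_ge0 => // x; exact: poweR_ge0.
  apply: le_average => //; try exact: mpow.
    by move=> x; exact: poweR_ge0.
  move=> x; apply: le_poweR; [exact: ltW|exact: Lip_ge0|exact: Lip_comp].
apply: le_trans (power_mean mX muB (M := L * M) p0 pq mgP _) _.
  move=> x; rewrite /= g0 /= /g EFinM; apply: lee_wpmul2l; first by rewrite lee_fin ltW.
  by apply: Lip_le => //; exact: ltW.
set W := average nu _ _.
have W0 : (0 <= W)%E by apply: average_ge0 => // x; exact: poweR_ge0.
have C0 : 0 <= K * (s / rho + 2) `^ Q by rewrite mulr_ge0 ?powR_ge0 // (le_trans _ K1).
have ge := @fold_average_ge a rho s (fun z => g z `^ q)%E rho0 Ls (mpow _ _ _ mg)
  (fun z => poweR_ge0 _ _).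
have gW : average nu (ball a s) (fun z => g z `^ q)%E = ((L `^ q)%:E * W)%E.
  rewrite -averageZl ?powR_ge0 //.
  - by congr average; apply/funext => z; rewrite /g poweRM ?lee_fin ?Lip_ge0 // ltW.
  - exact: mpow.
  - by move=> z; exact: poweR_ge0.
rewrite gW in ge; clearbody W.
rewrite [leRHS](_ : _ = (2%:E * (((K * (s / rho + 2) `^ Q) `^ q^-1 * L)%:E * W `^ q^-1))%E);
  last by rewrite EFinM muleA.
apply: lee_pmul => //; try exact: poweR_ge0.
  rewrite poweR_EFin lee_fin; apply: ler1_powR; first by rewrite ler1n.
  by rewrite invf_le1.
apply: (@le_trans _ _ (((K * (s / rho + 2) `^ Q)%:E * ((L `^ q)%:E * W)) `^ q^-1)%E).
  apply: le_poweR ge; first by rewrite invr_ge0 ltW.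
  by apply: average_ge0 => // x; exact: poweR_ge0.
rewrite !poweRM ?mule_ge0 ?lee_fin ?powR_ge0 // !poweR_EFin.
rewrite -[in leLHS]powRrM mulfV ?gt_eqF // powRr1; last exact: ltW.
by rewrite muleA -EFinM.
Qed.

(* In [poincare] one constant serves both as dilation and as factor, so the
   factor has to be sublinear in the dilation [T]; it grows like [T `^ (Q / q)],
   and the exponent [q] is chosen with [Q / q <= 1 / 2]. *)
Lemma fold_poincare : poincare nu (p + 2 * Q).
Proof.
have [C C0 Cp] := mu_poincare; have [M M1 diamM] := fold_diam.
set q := p + 2 * Q.
have pq : p <= q by have := Q0; rewrite /q; lra.
have q1 : 1 <= q by exact: le_trans pq.
have q0 : 0 < q by exact: lt_le_trans q1.
pose k := K * (3 * L) `^ Q.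
have k0 : 0 <= k by rewrite mulr_ge0 ?powR_ge0 // (le_trans _ K1).
have K0 : 0 < K by exact: lt_le_trans K1.
have M0 : 0 < M by exact: lt_le_trans M1.
(* [E] collects 2 from the oscillation, [k] from the averages, [M] from the diameters and
   [2 * L * K] from the Lipschitz term. *)
pose E := 4 * k * M * L * K.
have E0 : 0 <= E by rewrite /E mulr_ge0 ?(ltW K0) // mulr_ge0 ?(ltW L0) // mulr_ge0 ?(ltW M0) // mulr_ge0.
(* The square gives [E <= sqrt T], so that [E * sqrt T <= T]. The summand [3 * L] makes the dilated
   ball large enough for [fold_average_ge] and ensures [T / 3 + 2 <= T]. *)
pose T := E ^+ 2 + 3 * L.
have TL : 3 * L <= T by rewrite lerDr sqr_ge0.
have T3 : 3 <= T by have := L1; lra.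
have T0 : 0 < T by lra.
exists (C * T) => [|a r u r0 uLip _]; first exact: mulr_gt0.
cbv zeta; set CB := ball a (C * T * r); set B := ball a r.
have [N N0 uN] := lipschitz_funP uLip.
pose v := u \o P.
have vLip : lipschitz_fun v.
  exists (N * L) => x y; apply: le_trans (uN _ _) _.
  by rewrite -mulrA ler_wpM2l // ltW.
have vc : compactly_supported v by apply: (subclosed_compact _ cX) => //; exact: closed_closure.
have r3 : 0 < 3 * r by lra.
have H := Cp (j a) (3 * r) v r3 vLip vc; cbv zeta in H.
set c := fine _ in H; set V := (average mu _ _ `^ _)%E in H.
have rho0 : 0 < C * (3 * r) by exact: mulr_gt0.
have Ls : L * (C * (3 * r)) <= C * T * r.
  rewrite (_ : L * _ = C * (3 * L) * r); last by ring.
  by rewrite ler_wpM2r ?ler_wpM2l // ltW.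
have VW := fold_Lip_average a uLip pq rho0 Ls.
rewrite -/V -/CB in VW; set W := (average nu CB _ `^ _)%E in VW *.
have W0 : (0 <= W)%E by exact: poweR_ge0.
have V0 : (0 <= V)%E by exact: poweR_ge0.
have nuB := fold_ball_finite a r0; have [muf _] := mu_doubling.
have mZ := @measurable_mdist_ball R Z a r.
have ub x : `|u x| <= `|u a| + N * D.
  have := ler_normD (u x - u a) (u a); rewrite subrK => h; apply: (le_trans h).
  rewrite addrC lerD2l; apply: le_trans (uN _ _) _.
  by rewrite ler_wpM2l // ?(ltW N0) // -j_iso.
apply: le_trans (average_oscillation mZ nuB c (lipschitz_measurable uLip) ub) _.
have mc : measurable_fun [set: borel Z] ((fun y => `|u y - c|%:E) : borel Z -> \bar R).
  apply/measurable_EFinP; apply: measurableT_comp; first exact: normr_measurable.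
  by apply: measurable_funB; [exact: lipschitz_measurable|exact: measurable_cst].
have h0 (x : Z) : (0 <= `|u x - c|%:E)%E by rewrite lee_fin.
have Hle := fold_average_le a r0 mc h0.
pose kap := K * T `^ 2^-1 * L.
have kap0 : 0 <= kap by rewrite mulr_ge0 ?(ltW L0) // mulr_ge0 ?powR_ge0 ?(ltW K0).
have VW' : (V <= (2 * kap)%:E * W)%E.
  apply: (le_trans VW); apply: lee_wpmul2r => //; rewrite lee_fin ler_wpM2l //.
  rewrite ler_wpM2r //; first exact: ltW.
  have -> : C * T * r / (C * (3 * r)) = T / 3 by field; lra.
  apply: (@le_trans _ _ ((K * T `^ Q) `^ q^-1)).
    apply: ge0_ler_powR; rewrite ?nnegrE ?mulr_ge0 ?powR_ge0 ?invr_ge0 //; try exact: ltW.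
    rewrite ler_wpM2l //; first exact: ltW.
    apply: ge0_ler_powR; rewrite ?nnegrE //; lra.
  rewrite powRM ?powR_ge0 //; last exact: ltW.
  apply: ler_pM; rewrite ?powR_ge0 //.
    by apply: ler1_powR => //; rewrite invf_le1.
  rewrite -powRrM ler_powR //; first lra.
  by rewrite ler_pdivrMr //; have := Q0; have := p1; rewrite /q; lra.
apply: (@le_trans _ _ (2%:E * (k%:E * ((C * M)%:E * diam B * ((2 * kap)%:E * W))))%E).
  apply: lee_wpmul2l => //; apply: (le_trans Hle); apply: lee_wpmul2l; first by rewrite lee_fin.
  apply: (le_trans H); apply: lee_pmul => //.
    by rewrite mule_ge0 ?lee_fin ?(ltW C0) // /diam le_max lexx.
  by rewrite EFinM -muleA lee_wpmul2l ?lee_fin ?(ltW C0) // diamM.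
rewrite (muleACA (C * M)%:E) -EFinM !muleA -!EFinM.
apply: lee_wpmul2r => //; apply: lee_wpmul2r; first by rewrite /diam le_max lexx.
pose h := T `^ 2^-1.
have hh : h * h = T by rewrite /h powR12_sqrt ?ltW // -expr2 sqr_sqrtr // ltW.
have Eh : E <= h.
  rewrite /h powR12_sqrt; last exact: ltW.
  by rewrite -(ger0_norm E0) -sqrtr_sqr ler_wsqrtr // lerDl mulr_ge0 // ltW.
have h0' : 0 <= h by exact: powR_ge0.
rewrite lee_fin [leLHS](_ : _ = C * (E * h)); last by rewrite /E /kap -/h; clearbody h k; ring.
by rewrite ler_wpM2l ?(ltW C0) // -hh ler_wpM2r.
Qed.

End fold.

(** * The pillow space *)

(* [seq.prefix] shadows the [prefix] of Defs. *)
Import Defs.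

(** * Comparison of [d0] with coordinate differences *)

Section pillow_distance.
Context {R : realType}.
Implicit Types (p q : R * R) (w : nat -> bool).

Lemma triadic_refl N (c : R) : 0 <= c <= 1 -> triadic N c c.
Proof.
move=> c01; have M0 : 0 < 3 ^+ N :> R by exact: exprn_gt0.
have [||k k3 kc] := @triadic_ex R (3 ^ N) (3 ^+ N) c _ M0.
- by rewrite expn_gt0.
- by rewrite natrX divff ?gt_eqF.
by exists k.
Qed.

(** [F] stands for an axis-parallel segment. The chain stops at the triadic points between [c0] and
    [c], so each step stays in one cell and the lengths add up exactly. *)
Lemma chained_line n w (F : R -> R * R) :
    (forall c c', 0 <= c <= 1 -> 0 <= c' <= 1 -> triadic n.+1 c c' ->
      in_common_cell (prefix n (lift_seq w (F c))) (prefix n (lift_seq w (F c')))) ->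
    (forall c c', euclid (F c) (F c') = `|c - c'|) ->
  forall c0 c : R, 0 <= c0 -> c0 <= c -> c <= 1 ->
  chained (prefix n (lift_seq w (F c))) (prefix n (lift_seq w (F c0))) (c - c0).
Proof.
move=> Fc Fe c0 c c00 c0c c1; pose M : R := 3 ^+ n.+1.
have M0 : 0 < M by exact: exprn_gt0.
have ME : M = (3 ^ n.+1)%:R by rewrite natrX.
have FX c' : 0 <= c' <= 1 -> Xn (prefix n (lift_seq w (F c'))).
  move=> c'01; apply: (@common_cell_Xn _ _ _ (prefix n (lift_seq w (F c')))).
  by apply: Fc => //; exact: triadic_refl.
suff H k : (k <= 3 ^ n.+1)%N -> forall c', c0 <= c' -> c' <= k%:R / M ->
    chained (prefix n (lift_seq w (F c'))) (prefix n (lift_seq w (F c0))) (c' - c0).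
  by apply: (H (3 ^ n.+1)%N) => //; rewrite -ME divff ?gt_eqF.
elim: k => [_ c' c0c' |k IH k3 c' c0c' c'k].
  rewrite mul0r => c'0; have -> : c' = c0 by lra.
  by rewrite subrr; apply: chained_refl; apply: FX; lra.
have k0 : 0 <= k%:R / M by rewrite divr_ge0 // ltW.
have k1 : k.+1%:R / M <= 1 by rewrite ler_pdivrMr // mul1r ME ler_nat.
have [c'k'|kc'] := leP c' (k%:R / M); first by apply: IH => //; exact: ltnW.
(* If [k / M] is at most [c0], both ends lie in one triadic interval and a single step suffices. *)
have [kc0|c0k] := leP (k%:R / M) c0.
  rewrite -(ger0_norm (_ : 0 <= c' - c0)); last by rewrite subr_ge0.
  rewrite -Fe; apply: chained_step; apply: Fc; [lra|lra|].
  by exists k => //; rewrite -/M; split; apply/andP; split; lra.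
rewrite (_ : c' - c0 = (c' - k%:R / M) + (k%:R / M - c0)); last by ring.
apply: (@chained_cat _ _ _ (prefix n (lift_seq w (F (k%:R / M))))); last first.
  by apply: IH => //; [exact: ltnW|exact: ltW].
rewrite -(ger0_norm (_ : 0 <= c' - k%:R / M)); last by rewrite subr_ge0 ltW.
rewrite -Fe; apply: chained_step; apply: Fc; [lra|lra|].
by exists k => //; rewrite -/M; split; apply/andP; split; lra.
Qed.

Lemma chained_line_sym n w (F : R -> R * R) :
    (forall c c', 0 <= c <= 1 -> 0 <= c' <= 1 -> triadic n.+1 c c' ->
      in_common_cell (prefix n (lift_seq w (F c))) (prefix n (lift_seq w (F c')))) ->
    (forall c c', euclid (F c) (F c') = `|c - c'|) ->
  forall c c' : R, 0 <= c <= 1 -> 0 <= c' <= 1 ->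
  chained (prefix n (lift_seq w (F c))) (prefix n (lift_seq w (F c'))) `|c - c'|.
Proof.
move=> Fc Fe c c' c01 c'01; have [cc'|cc'] := leP c c'.
  rewrite distrC ger0_norm ?subr_ge0 //; apply: chained_sym.
    apply: (@common_cell_Xn _ _ _ (prefix n (lift_seq w (F c)))).
    by apply: Fc => //; exact: triadic_refl.
  by apply: chained_line => //; lra.
rewrite ger0_norm ?subr_ge0 ?ltW //; apply: chained_line => //; lra.
Qed.

(** A horizontal segment followed by a vertical one, both lifted to the sheet. The bound is free of
    [n] and so survives in the limit. *)
Lemma dn_lift_le n w p q : unit_square p -> unit_square q ->
  dn (prefix n (lift_seq w p)) (prefix n (lift_seq w q)) <=
  `|p.1 - q.1| + `|p.2 - q.2|.
Proof.
case: p q => [a b] [a' b'] [/= a01 b01] [/= a'01 b'01]; apply: dn_le.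
apply: (@chained_cat _ _ _ (prefix n (lift_seq w (a', b)))).
  apply: (@chained_line_sym _ _ (fun c => (c, b))) => // [c c' c01 c'01 cc'|c c'].
    by apply: lift_cell => //=; exact: triadic_refl.
  exact: euclid_l.
apply: (@chained_line_sym _ _ (fun c => (a', c))) => // [c c' c01 c'01 cc'|c c'].
  by apply: lift_cell => //=; exact: triadic_refl.
exact: euclid_r.
Qed.

Lemma d0_le (x y : pillow R) (l : R) :
  (forall n, dn (prefix n (val x)) (prefix n (val y)) <= l) -> d0 x y <= l.
Proof. by move=> xyl; apply: limr_le; [exact: cvg_dn|exact: nearW]. Qed.

Lemma d0_sheet_le w (p q : @unit_square R) :
  d0 (sheet_map w p) (sheet_map w q) <=
  `|(val p).1 - (val q).1| + `|(val p).2 - (val q).2|.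
Proof.
by apply: d0_le => n; apply: dn_lift_le; [exact: set_mem (valP p)|exact: set_mem (valP q)].
Qed.

Lemma d0_le4 (x y : pillow R) : d0 x y <= 4.
Proof.
apply: d0_le => n; have [l l4 xyl] := chained_pillow n (pillowP x) (pillowP y).
exact: le_trans (dn_le xyl) l4.
Qed.

(** The distances [dn] increase with [n], so the one at index 0 is a lower bound, and along its
    chains each coordinate is 1-Lipschitz; 2 counts the coordinates. *)
Lemma d0_ge_proj (x y : pillow R) :
  `|(proj (val x 0%N)).1 - (proj (val y 0%N)).1| +
  `|(proj (val x 0%N)).2 - (proj (val y 0%N)).2| <= 2 * d0 x y.
Proof.
have nd : nondecreasing_seq (fun n => dn (prefix n (val x)) (prefix n (val y))).
  by apply/nondecreasing_seqP => k; apply: dn_prefixS; exact: pillowP.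
have h0 := nondecreasing_cvgn_le nd (@cvg_dn R x y) 0%N.
have h1 := @dn_lip R 0 (fun z => (proj (z ord0)).1) _ _ (pillowP x) (pillowP y)
  (fun z z' _ => euclidl _ _).
have h2 := @dn_lip R 0 (fun z => (proj (z ord0)).2) _ _ (pillowP x) (pillowP y)
  (fun z z' _ => euclidr _ _).
rewrite /= in h1 h2; rewrite /d0; rewrite /prefix /= in h0 h1 h2 *; lra.
Qed.

End pillow_distance.

(** * The folding map onto a sheet and the isometries of its fibers *)

Section pillow_fold.
Context {R : realType}.
Variable w : nat -> bool.

Definition base (x : pillow R) : @unit_square R :=
  exist (fun p => p \in @unit_square R) (proj (val x 0%N))
    (mem_set ((pillowP x).1 0%N).1).

Definition sheet_point (p : @unit_square R) : sheet_space R w :=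
  exist (fun x => x \in sheet w) (sheet_map w p)
    (mem_set (imageP (sheet_map w) (I : [set: @unit_square R] p))).

Definition sheet_fold (x : pillow R) : sheet_space R w := sheet_point (base x).

Lemma base_sheet_map v (p : @unit_square R) : base (sheet_map v p) = p.
Proof. exact: set_type_val_inj. Qed.

Lemma sheet_foldK (a : sheet_space R w) : sheet_fold (val a) = a.
Proof.
apply: set_type_val_inj; have [p _ pa] := set_mem (valP a).
by rewrite /= -pa base_sheet_map.
Qed.

Lemma iota_mapK v : involutive (iota_map v : pillow R -> pillow R).
Proof.
move=> x; apply: set_type_val_inj; apply/funext => i /=; rewrite /swap /proj.
case: (val x i) => q b /=; case vi: (v i && in_center q) => /=; last by rewrite vi.
by rewrite vi negbK.
Qed.

Lemma proj_swap k (x : R * R * bool) : proj (swap k x) = proj x.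
Proof. by rewrite /swap; case: ifP. Qed.

Lemma sheet_fold_iota v (x : pillow R) : sheet_fold (iota_map v x) = sheet_fold x.
Proof.
rewrite /sheet_fold; congr sheet_point; apply: set_type_val_inj.
by rewrite /= proj_swap.
Qed.

(** Over the open central square a swap is made exactly when the tag of [x] differs from [w].
    Elsewhere the swap is trivial and both tags are [false]. *)
Lemma iota_sheet_fold (x : pillow R) :
  iota_map (fun i => w i (+) (val x i).2) x = val (sheet_fold x).
Proof.
apply: set_type_val_inj; apply/funext => i.
rewrite /= -/(lift_seq w (proj (val x 0%N)) i).
have := congr1 (fun z => z i) (liftE (pillowP x)); rewrite /lift_seq /=.
set q := iter _ _ _ => xi; have := ((pillowP x).1 i).2.
rewrite xi /section1 /swap /proj /=.
by case: (in_center q); case: (val x i).2; case: (w i) => //= h; have := h isT.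
Qed.

End pillow_fold.

(** * Boundedness of the control function *)

Section eta_bound.
Context {R : realType}.

(** The retraction [h] of the line onto the half-line turns [eta] into a continuous function on a
    real interval, where it attains its maximum. *)
Lemma halfline_bounded (eta : @halfline R -> @halfline R) (t : R) :
  continuous eta -> exists B, forall s, val s <= t -> val (eta s) <= B.
Proof.
move=> ceta.
have hP (s : R) : Num.max 0 s \in @halfline R by rewrite inE /halfline /= le_max lexx.
pose h (s : R) : @halfline R := exist (fun x => x \in @halfline R) _ (hP s).
have ch : continuous h.
  apply: continuous_comp_initial => s; apply/cvgrPdist_lt => e e0; near=> y.
  apply: le_lt_trans (max_lip (lexx _)) _; near: y; exact: (@nbhsx_ballx R R s e e0).
have cv : continuous (fun s => val (eta (h s)) : R).
  move=> s; apply: (@continuous_comp _ _ _ (eta \o h) val).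
    by apply: continuous_comp; [exact: ch|exact: ceta].
  exact: initial_continuous.
have [t0|t0] := leP 0 t; last first.
  exists 0 => s st; have s0 : 0 <= val s by exact: set_mem (valP s).
  by have := le_lt_trans (le_trans s0 st) t0; rewrite ltxx.
have [c _ cmax] := EVT_max t0 (continuous_subspaceT cv).
exists (val (eta (h c))) => s st; have s0 : 0 <= val s by exact: set_mem (valP s).
have -> : s = h (val s).
  by apply: set_type_val_inj; rewrite /= max_r.
by apply: cmax; rewrite in_itv /= s0 st.
Unshelve. all: by end_near. Qed.

End eta_bound.

(** * Consequences of quasisymmetry *)

Section quasisymmetric_sheet.
Context {R : realType}.
Variables (d : metric_on R (pillow R)) (w : nat -> bool).
Hypothesis d_sym : symmetric_metric d.
Hypothesis d_qs : quasisymmetric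
  (fun x : metric_space (@pillow_metric R) => x : metric_space d).

(** Weak quasisymmetry: ratios of d_0 up to [t] keep the ratios of [d] below a bound for [eta] on
    [[0, t]]. *)
Lemma qs_bound (t : R) : exists2 B : R, 0 <= B &
  forall x y z : pillow R, x <> z -> d0 x y <= t * d0 x z -> d x y <= B * d x z.
Proof.
have [_ [eta [eta' [_ _ ceta _]] dq]] := d_qs.
have [B BP] := halfline_bounded t ceta.
exists (Num.max 0 B) => [|x y z xz xyz]; first by rewrite le_max lexx.
have xz0 : 0 < d0 x z.
  by rewrite (@mdist_gt0 R (metric_space (@pillow_metric R)) x z); exact/eqP.
have dxz0 : 0 < d x z.
  by rewrite (@mdist_gt0 R (metric_space d) x z); exact/eqP.
have sP : d0 x y / d0 x z \in @halfline R.
  rewrite inE /halfline /= divr_ge0 ?(ltW xz0) //.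
  exact: (@mdist_ge0 R (metric_space (@pillow_metric R)) x y).
pose s : @halfline R := exist (fun x => x \in @halfline R) _ sP.
have := dq x y z s xz (erefl _).
rewrite [X in X / _](_ : _ = d x y) // [X in _ / X](_ : _ = d x z) //.
rewrite ler_pdivrMr // => /le_trans; apply; rewrite ler_wpM2r ?(ltW dxz0) //.
apply: le_trans (BP s _) _; first by rewrite /= ler_pdivrMr.
by rewrite le_max lexx orbT.
Qed.

Lemma sheet_fold_lip : exists2 L : R, 1 <= L & forall x y : metric_space d,
  mdist (sheet_fold w x : metric_space (sheet_metric w d)) (sheet_fold w y)
    <= L * mdist x y.
Proof.
have [B B0 BP] := qs_bound 2.
exists (Num.max 1 B) => [|x y]; first by rewrite le_max lexx.
pose v i := w i (+) (val x i).2.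
have gx : iota_map v x = val (sheet_fold w x) by exact: iota_sheet_fold.
have gy : sheet_fold w (iota_map v y) = sheet_fold w y by exact: sheet_fold_iota.
have -> : mdist x y = d (iota_map v x) (iota_map v y) by rewrite d_sym.
change (d (val (sheet_fold w x)) (val (sheet_fold w y)) <=
  Num.max 1 B * d (iota_map v x) (iota_map v y)).
(* When the two points coincide the ratio has denominator 0, but then [x] and [y] have the same
   image. *)
rewrite gx; have [xy|xy] := pselect (val (sheet_fold w x) = iota_map v y).
  have -> : sheet_fold w y = sheet_fold w x by rewrite -gy -xy sheet_foldK.
  rewrite distxx mulr_ge0 ?le_max ?ler01 //.
  exact: (@mdist_ge0 R (metric_space d)).
apply: le_trans (BP _ _ _ xy _) _.
  apply: le_trans (d0_sheet_le w (base x) (base y)) _.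
  have := d0_ge_proj (val (sheet_fold w x)) (iota_map v y).
  by rewrite /= proj_swap.
rewrite ler_wpM2r //; first exact: (@mdist_ge0 R (metric_space d)).
by rewrite le_max lexx orbT.
Qed.

Lemma unit_square_exist (s t : R) :
  (Num.max 0 (Num.min 1 s), Num.max 0 (Num.min 1 t)) \in @unit_square R.
Proof.
rewrite inE; split => /=; rewrite le_max lexx /= ge_max ler01 /= ge_min lexx.
all: by [].
Qed.

Definition clamp (s t : R) : @unit_square R :=
  exist (fun p => p \in @unit_square R) _ (unit_square_exist s t).

Lemma pillow_neq : exists x y : sheet_space R w, x <> y.
Proof.
exists (sheet_point w (clamp 0 0)), (sheet_point w (clamp 1 1)).
move=> /(congr1 (fun a => (proj (val (val a) 0%N)).1)) /=.
by rewrite minxx (min_r ler01) maxxx (max_r ler01) => /eqP; rewrite eq_sym oner_eq0.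
Qed.

(** Since d_0 is at most 4, every distance from [a] is controlled by comparison with one fixed pair
    [a], [b]. *)
Lemma qs_bounded : exists D : R, forall x y : metric_space d, mdist x y <= D.
Proof.
have [a [b ab]] := pillow_neq.
have abv : val a <> val b by move=> /set_type_val_inj.
have ab0 : 0 < d0 (val a) (val b).
  by rewrite (@mdist_gt0 R (metric_space (@pillow_metric R))); exact/eqP.
have [B B0 BP] := qs_bound (4 / d0 (val a) (val b)).
have h x : d (val a) x <= B * d (val a) (val b).
  by apply: BP => //; rewrite divfK ?gt_eqF //; exact: d0_le4.
exists (B * d (val a) (val b) + B * d (val a) (val b)) => x y.
change (d x y <= B * d (val a) (val b) + B * d (val a) (val b)).
by apply: le_trans (dist_triangle d (val a) x y) _; rewrite lerD // dist_sym.
Qed.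

Lemma clamp_lip (s t : R) :
  `|Num.max 0 (Num.min 1 s) - Num.max 0 (Num.min 1 t)| <= `|s - t|.
Proof.
by apply: max_lip; apply: min_lip => //; rewrite subrr normr0.
Qed.

(** The sheet is a union of radial paths from the point over [(0, 0)]. They are continuous for d_0
    by [d0_sheet_le], and the identity to [d] is continuous. *)
Lemma sheet_connected : connected [set: metric_space (sheet_metric w d)].
Proof.
have [[f' [_ _ cid _]] _] := d_qs.
pose gam (a : sheet_space R w) (t : R) : sheet_space R w :=
  sheet_point w (clamp (t * (proj (val (val a) 0%N)).1) (t * (proj (val (val a) 0%N)).2)).
have gam1 a : gam a 1 = a.
  rewrite -[RHS]sheet_foldK; congr sheet_point; apply: set_type_val_inj => /=.
  have [p1 p2] := ((pillowP (val a)).1 0%N).1.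
  rewrite !mul1r !min_r ?max_r; try by [case/andP: p1|case/andP: p2].
  by case: (val (val a) 0%N) => -[].
have gam0 a b : gam a 0 = gam b 0 by rewrite /gam !mul0r.
have cgam a : continuous (gam a : R -> metric_space (sheet_metric w d)).
  move=> t0; apply/metricType_numDomainType.cvgrPdist_lt => e e0.
  have := cid (val (gam a t0)).
  move=> /metricType_numDomainType.cvgrPdist_lt/(_ e e0).
  move=> /metricType_numDomainType.nbhs_mdistP[r /= r0 rP].
  have [p1 p2] := ((pillowP (val a)).1 0%N).1.
  near=> t; apply: rP => /=.
  apply: le_lt_trans (d0_sheet_le _ _ _) _ => /=.
  have small q : 0 <= q <= 1 -> `|Num.max 0 (Num.min 1 (t0 * q)) - Num.max 0 (Num.min 1 (t * q))| <= `|t0 - t|.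
    move=> /andP[q0 q1]; apply: le_trans (clamp_lip _ _) _.
    by rewrite -mulrBl normrM (ger0_norm q0) ler_piMr.
  have tr : `|t0 - t| < r / 2.
    by near: t; apply: (@nbhsx_ballx R R t0 (r / 2)); rewrite divr_gt0.
  by have := small _ p1; have := small _ p2; lra.
rewrite (_ : setT = \bigcup_(a in [set: sheet_space R w]) (gam a @` `[0, 1])); last first.
  by apply/seteqP; split => // a _; exists a => //; exists 1; rewrite ?gam1 //= in_itv /= ler01 lexx.
apply: bigcup_connected.
  exists (gam point 0) => a _; exists 0; first by rewrite /= in_itv /= lexx ler01.
  exact: gam0.
move=> a _; apply: connected_continuous_connected; first exact: segment_connected.
by apply: continuous_subspaceT; exact: cgam.
Unshelve. all: by end_near. Qed.

End quasisymmetric_sheet.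

Theorem corollary1p7 (R : realType) (dSL : metric_on R (pillow R))
    (w : nat -> bool) :
  symmetric_metric dSL ->
  loewner (metric_space dSL) ->
  quasisymmetric
    (fun x : metric_space (@pillow_metric R) => x : metric_space dSL) ->
  exists nu : {measure set (borel (metric_space (sheet_metric w dSL))) -> \bar R},
    PI_space nu.
Proof.
move=> d_sym [Q [Q1 completeX Qreg [mu muE [_ _ mu_radon mu_doubling mu_poincare]]]] qs.
have Q0 : 0 <= Q by rewrite ltW // (lt_trans _ Q1).
have [D XD] := qs_bounded w qs.
have mufin := bounded_finite_measure mu_doubling XD.
have cX := bounded_ahlfors_compact muE Qreg completeX mu_doubling XD.
have [K K1 ratio] := ahlfors_ratio muE Qreg Q0.
have [L L1 P_lip] := sheet_fold_lip w d_sym qs.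
have [z0 [z1 z01]] := @pillow_neq R w.
pose P (x : metric_space dSL) : metric_space (sheet_metric w dSL) := sheet_fold w x.
pose j (a : metric_space (sheet_metric w dSL)) : metric_space dSL := val a.
have jK a : P (j a) = a by exact: sheet_foldK.
have j_iso a b : mdist (j a) (j b) = mdist a b by [].
have mP : measurable_fun [set: borel (metric_space dSL)]
    (P : borel (metric_space dSL) -> borel (metric_space (sheet_metric w dSL))).
  exact: fold_measurable L1 P_lip.
have fiber_sym x : exists g : metric_space dSL -> metric_space dSL,
    [/\ involutive g, forall y z, mdist (g y) (g z) = mdist y z,
      forall y, P (g y) = P y,
      forall A, measurable (A : set (borel (metric_space dSL))) ->
        mu (g @^-1` A : set (borel (metric_space dSL))) = mu A & g x = j (P x)].
  pose v i := w i (+) (val x i).2.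
  have gi (y z : metric_space dSL) :
      mdist (iota_map v y : metric_space dSL) (iota_map v z) = mdist y z.
    exact: d_sym.
  exists (iota_map v); split => //; first exact: iota_mapK.
  - by move=> y; exact: sheet_fold_iota.
  - move=> A mA.
    have cg : continuous (iota_map v : metric_space dSL -> metric_space dSL).
      by apply: (@lipschitz_continuous R _ _ _ 1) => // y z; rewrite gi mul1r.
    (* As a Hausdorff measure, [mu] is invariant under the isometries. *)
    rewrite !muE //; first by apply: isometric_hausdorff => //; exact: iota_mapK.
    by rewrite -[X in measurable X]setTI; apply: (continuous_borel_measurable cg).
  exact: iota_sheet_fold.
pose nu := measure_function_pushforward__canonical__measure_function_Measure mu mP.
have nuE A : nu A = mu (P @^-1` A) by [].
(* This is the exponent of [fold_poincare] for [p] equal to [Q]. *)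
exists nu, (Q + 2 * Q); split.
- lra.
- move=> F PF cF; apply: compact_cauchy_cvg cF filterT _.
  exact: (fold_compact L1 P_lip jK cX).
- exact: (fold_radon L1 P_lip mufin nuE cX mu_radon).
- exact: (fold_doubling L1 P_lip j_iso jK mufin mu_doubling fiber_sym nuE K1 ratio).
- apply: (fold_poincare L1 P_lip j_iso jK mufin mu_doubling fiber_sym nuE Q0 K1
    ratio cX XD _ z01 (ltW Q1) mu_poincare).
  exact: sheet_connected.
Qed.
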